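(* (i) Let $\gamma: S^1\to Q$ be a generic smooth closed immersed curve on one sheet $Q=\{(x,y,z)\in\mathbb{R}^3\mid z^2-x^2-y^2=1,\ z>0\}$ of the two-sheeted hyperboloid, and let $a$ be the number of its double points. Then $\gamma$ has at least $a+2$ pairs of tangent lines that are parallel in the ambient space $\mathbb{R}^3$. (ii) Let $\gamma: S^1\to Q$ be a generic smooth closed immersed curve on the one-sheeted hyperboloid $Q=\{(x,y,z)\in\mathbb{R}^3\mid x^2+y^2-z^2=1\}$, and assume that $\gamma$ is space-like, i.e. the quadratic form $x^2+y^2-z^2$ evaluated on the tangent vector of $\gamma$ is everywhere positive. Let $a$ be the number of double points of $\gamma$ and $b$ the number of intersections of $\gamma$ with its antipodal image. Then $\gamma$ has at least $a+b$ pairs of tangent lines that are parallel in $\mathbb{R}^3$. If $a=b=0$, then there are at least $2$ pairs of parallel tangent lines.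
   Context: Pairs of parallel tangent lines are counted as unordered pairs $\{s,t\}\subset S^1$, $s\neq t$, such that $\gamma'(s)$ and $\gamma'(t)$ are proportional vectors in $\mathbb{R}^3$. The number $a$ of double points is the number of unordered pairs $\{s,t\}$, $s\ne t$, with $\gamma(s)=\gamma(t)$. The number $b$ of intersections with the antipodal image is the number of unordered pairs $\{s,t\}$ with $\gamma(t)=-\gamma(s)$. Generic: let $u\cdot v$ denote the symmetric bilinear form on $\mathbb{R}^3$ associated with the quadratic form $z^2-x^2-y^2$ in case (i) and $x^2+y^2-z^2$ in case (ii). Put $\phi(s,t)=\gamma(s)\cdot\gamma(t)$ on $S^1\times S^1$, $A=\{(s,t)\mid s\ne t,\ \gamma(s)=\gamma(t)\}$, $B=\{(s,t)\mid \gamma(t)=-\gamma(s)\}$ ($B$ is empty in case (i)), and $D=\{(s,s)\}$. The curve $\gamma$ is generic if $\gamma'(s)$ and $\gamma'(t)$ are linearly independent for all $(s,t)\in A\cup B$ (transversality of self-intersections and of intersections with the antipodal image $-\gamma$), and $\phi$ restricted to $(S^1\times S^1)\setminus(A\cup B\cup D)$ is a Morse function (all critical points there are non-degenerate). *)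

(* Defs.v *)
From HB Require Import structures.
From mathcomp Require Import all_boot all_order all_algebra.
From mathcomp Require Import all_classical all_reals all_analysis.
Import Order.TTheory GRing.Theory Num.Theory.
Import numFieldNormedType.Exports.
Set Implicit Arguments.
Unset Strict Implicit.
Unset Printing Implicit Defensive.

Local Open Scope ring_scope.
Local Open Scope classical_set_scope.

(* The circle is R/Z: a map on it is a 1-periodic map on R, and its points are
   represented by the elements of [0, 1[. *)
Definition circle {R : realType} : set R := [set t : R | 0 <= t < 1].

Definition smooth {R : realType} (g : R -> 'rV[R]_3) : Prop :=
  forall (n : nat) (t : R), derivable g^`(n) t 1.

Definition smooth_closed_immersed {R : realType} (g : R -> 'rV[R]_3) : Prop :=
  [/\ periodic g 1, smooth g & forall t : R, derive1 g t != 0].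

(* The coordinates of p are x = p 0 0, y = p 0 1, z = p 0 2. *)
Definition upper_sheet {R : realType} : set 'rV[R]_3 :=
  [set p : 'rV[R]_3 | p 0 2 ^+ 2 - p 0 0 ^+ 2 - p 0 1 ^+ 2 = 1 /\ 0 < p 0 2].

Definition one_sheet {R : realType} : set 'rV[R]_3 :=
  [set p : 'rV[R]_3 | p 0 0 ^+ 2 + p 0 1 ^+ 2 - p 0 2 ^+ 2 = 1].

Definition timelike_form {R : realType} (u v : 'rV[R]_3) : R :=
  u 0 2 * v 0 2 - u 0 0 * v 0 0 - u 0 1 * v 0 1.

Definition spacelike_form {R : realType} (u v : 'rV[R]_3) : R :=
  u 0 0 * v 0 0 + u 0 1 * v 0 1 - u 0 2 * v 0 2.

Definition torus {R : realType} : set (R * R) := circle `*` circle.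

Definition diagonal {R : realType} : set (R * R) :=
  [set p : R * R | torus p /\ p.1 = p.2].

Definition double_points {R : realType} (g : R -> 'rV[R]_3) : set (R * R) :=
  [set p : R * R | [/\ torus p, p.1 != p.2 & g p.1 = g p.2]].

Definition antipodal_points {R : realType} (g : R -> 'rV[R]_3) : set (R * R) :=
  [set p : R * R | torus p /\ g p.2 = - g p.1].

(* The curve is immersed, so its velocity vectors are nonzero and proportional
   means a nonzero ratio. *)
Definition parallel_tangents {R : realType} (g : R -> 'rV[R]_3) : set (R * R) :=
  [set p : R * R | [/\ torus p, p.1 != p.2 &
                     exists2 c : R, c != 0 & derive1 g p.2 = c *: derive1 g p.1]].

(* For a symmetric subset E of the torus disjoint from the diagonal, every
   unordered pair {s, t} with (s, t) in E has a unique representative with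
   s < t; the result is +oo when there are infinitely many pairs. *)
Definition num_pairs {R : realType} (E : set (R * R)) : \bar R :=
  counting (E `&` [set p : R * R | p.1 < p.2]).

Definition critical_point {R : realType} (f : R * R -> R) (p : R * R) : Prop :=
  forall v : R * R, 'D_v f p = 0.

(* (v, w) |-> 'D_v ('D_w f) p is the Hessian bilinear form of f at p. *)
Definition nondegenerate {R : realType} (f : R * R -> R) (p : R * R) : Prop :=
  forall v : R * R, (forall w : R * R, 'D_v ('D_w f) p = 0) -> v = 0.

(* A function on the torus is given by its doubly periodic lift f to the plane,
   so derivatives at points of the torus are taken in the whole plane. *)
Definition morse_on {R : realType} (E : set (R * R)) (f : R * R -> R) : Prop :=
  forall p, E p -> critical_point f p -> nondegenerate f p.

Definition generic {R : realType} (q : 'rV[R]_3 -> 'rV[R]_3 -> R)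
    (g : R -> 'rV[R]_3) : Prop :=
  let AB := double_points g `|` antipodal_points g in
  (forall p, AB p -> free [:: derive1 g p.1; derive1 g p.2]) /\
  morse_on (torus `\` (AB `|` diagonal)) (fun p => q (g p.1) (g p.2)).

(* Main.v *)
Require Import Defs.
From mathcomp Require Import all_boot all_order all_algebra.
From mathcomp Require Import all_classical all_reals all_analysis.
From mathcomp Require Import lra ring zify finmap.
Import Order.TTheory GRing.Theory Num.Theory.
Import numFieldNormedType.Exports.
Set Implicit Arguments.
Unset Strict Implicit.
Unset Printing Implicit Defensive.
Local Open Scope ring_scope.
Local Open Scope classical_set_scope.

(* Both cases use the Lorentz form u.v = x x' + y y' - z z', for which
   g.g = sigma is constant, equal to -1 or 1, and g'.g' > 0.  Off the diagonal,
   the critical points of phi(s, t) = g(s).g(t) are the coincidences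
   g(t) = g(s) or g(t) = - g(s), and pairs with parallel tangents; all of them
   are nondegenerate.  On the annulus 0 < t - s < 1 the gradient of phi points
   towards the boundary near both boundary circles (phi is maximal on the
   diagonal, in the Morse-Bott sense), so the sum of its indices vanishes:
   there are as many saddles as extrema, say n of each with s < t.  A Gram
   determinant shows that coincidences are extrema if sigma = -1 and saddles
   if sigma = 1.  The minimum of phi is an extremum, and is less than sigma.
   So n >= 1, and among the 2n critical pairs the number c of coincidences is
   less than n if sigma = -1, and at most n if sigma = 1; the remaining 2n - c
   critical pairs have parallel tangents.

   The index sum is computed without integration: on a fine grid, the winding
   number of the field along a polygon is the signed number of crossings of
   the positive half-axis by the images of its edges. *)

(** * Winding numbers on a grid *)

Section Crossing.
Context {R : realFieldType}.
Implicit Types p q n : R * R.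

(* Signed crossing of the positive first half-axis by the segment from p to q;
   the sign of the determinant tells on which side of 0 the axis is crossed. *)
Definition crossing p q : int :=
  if [&& p.2 < 0, 0 <= q.2 & 0 < p.1 * q.2 - p.2 * q.1] then 1
  else if [&& q.2 < 0, 0 <= p.2 & p.1 * q.2 - p.2 * q.1 < 0] then -1 else 0.

Definition upper p : int := ((0 <= p.2)%R : nat)%:Z.

(* In an open half-plane the axis can only be crossed on one side of 0, so the
   crossing number is a coboundary. *)
Lemma crossing_halfplane n p q :
  0 < n.1 * p.1 + n.2 * p.2 -> 0 < n.1 * q.1 + n.2 * q.2 ->
  crossing p q = if 0 < n.1 then upper q - upper p else 0.
Proof.
rewrite /crossing /upper; case: n p q => [n1 n2] [p1 p2] [q1 q2] /= hp hq.
have E : n1 * (p1 * q2 - p2 * q1) =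
    (n1 * p1 + n2 * p2) * q2 - p2 * (n1 * q1 + n2 * q2) by ring.
set d := p1 * q2 - p2 * q1 in E *.
have H1 : p2 < 0 -> 0 <= q2 -> 0 < n1 * d by rewrite E; nra.
have H2 : q2 < 0 -> 0 <= p2 -> n1 * d < 0 by rewrite E; nra.
clear E; case: (ltP p2 0) H1 H2 => p20; case: (ltP q2 0) => q20 //= H1 H2;
  rewrite ?ltxx ?subrr ?sub0r ?subr0; try by case: ifP.
- have {}H1 := H1 isT isT; case: (ltP 0 d) => d0; case: (ltP 0 n1) => // n0; exfalso; nra.
- have {}H2 := H2 isT isT; case: (ltP d 0) => d0; case: (ltP 0 n1) => // n0; exfalso; nra.
Qed.

(** The map [f] multiplies determinants by [a * d - b * c], so all four edges turn about 0 in the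
    same sense, and only the signs of the second coordinates decide which of them cross the axis. *)
Lemma crossing_quadrants a b c d x1 y1 x2 y2 x3 y3 x4 y4 :
  let f x y : R * R := (a * x + b * y, c * x + d * y) in
  a * d - b * c != 0 ->
  x1 < 0 -> y1 < 0 -> 0 < x2 -> y2 < 0 -> 0 < x3 -> 0 < y3 -> x4 < 0 -> 0 < y4 ->
  crossing (f x1 y1) (f x2 y2) + crossing (f x2 y2) (f x3 y3)
  - crossing (f x4 y4) (f x3 y3) - crossing (f x1 y1) (f x4 y4)
  = sgz (a * d - b * c).
Proof.
move=> f D0 hx1 hy1 hx2 hy2 hx3 hy3 hx4 hy4.
have detE x y x' y' : (f x y).1 * (f x' y').2 - (f x y).2 * (f x' y').1 =
    (a * d - b * c) * (x * y' - y * x') by rewrite /f /=; ring.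
rewrite /crossing !detE /=.
have k12 : 0 < x1 * y2 - y1 * x2 by nra.
have k23 : 0 < x2 * y3 - y2 * x3 by nra.
have k43 : x4 * y3 - y4 * x3 < 0 by nra.
have k14 : x1 * y4 - y1 * x4 < 0 by nra.
have cd0 : (c != 0) || (d != 0).
  by apply/negP => /negP; rewrite negb_or !negbK => /andP[/eqP c0 /eqP d0];
     move: D0; rewrite c0 d0 !mulr0 subrr eqxx.
set D := a * d - b * c in D0 *.
set z1 := c * x1 + _; set z2 := c * x2 + _; set z3 := c * x3 + _; set z4 := c * x4 + _.
(* Opposite corners lie in opposite quadrants and [(c, d)] is nonzero, so the sign of the second
   coordinate separates some opposite pair. Hence exactly one edge has a nonzero crossing number. *)
have Z : [|| (z1 < 0) && ~~ (z3 < 0), (z3 < 0) && ~~ (z1 < 0), (z2 < 0) && ~~ (z4 < 0) | (z4 < 0) && ~~ (z2 < 0)].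
  rewrite /z1 /z2 /z3 /z4.
  case: (ltgtP c 0) cd0 => c0; case: (ltgtP d 0) => d0 //= _;
  apply/or4P; [constructor 2|constructor 3|constructor 2|constructor 4|constructor 1|
    constructor 1| constructor 2|constructor 1]; rewrite -leNgt; apply/andP; split; nra.
have [Dp|Dn|D0'] := ltgtP D 0; last by rewrite D0' eqxx in D0.
- rewrite ltr0_sgz // !(pmulr_lgt0 _ k12) !(pmulr_lgt0 _ k23) !(pmulr_llt0 _ k12) !(pmulr_llt0 _ k23).
  rewrite !(nmulr_lgt0 _ k43) !(nmulr_lgt0 _ k14) !(nmulr_llt0 _ k43) !(nmulr_llt0 _ k14).
  rewrite Dp (lt_gtF Dp).
  by rewrite !leNgt; move: Z; case: (z1 < 0); case: (z2 < 0); case: (z3 < 0); case: (z4 < 0).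
- rewrite gtr0_sgz // !(pmulr_lgt0 _ k12) !(pmulr_lgt0 _ k23) !(pmulr_llt0 _ k12) !(pmulr_llt0 _ k23).
  rewrite !(nmulr_lgt0 _ k43) !(nmulr_lgt0 _ k14) !(nmulr_llt0 _ k43) !(nmulr_llt0 _ k14).
  rewrite Dn (lt_gtF Dn).
  by rewrite !leNgt; move: Z; case: (z1 < 0); case: (z2 < 0); case: (z3 < 0); case: (z4 < 0).
Qed.

End Crossing.

Section Grid.
Context {R : realFieldType}.
Variable G : nat -> nat -> R * R.

(** The boundary is run through counterclockwise; the top and left edges get a minus sign because
    [crossing] is taken along increasing indices. *)
Definition cell_winding i j : int :=
  crossing (G i j) (G i.+1 j) + crossing (G i.+1 j) (G i.+1 j.+1)
  - crossing (G i j.+1) (G i.+1 j.+1) - crossing (G i j) (G i j.+1).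

(** A discrete Green formula: interior edges belong to two cells with opposite signs, so both
    directions telescope. *)
Lemma sum_cell_winding i0 i1 j0 j1 : (i0 <= i1)%N -> (j0 <= j1)%N ->
  \sum_(i0 <= i < i1) \sum_(j0 <= j < j1) cell_winding i j =
    \sum_(i0 <= i < i1) crossing (G i j0) (G i.+1 j0)
    + \sum_(j0 <= j < j1) crossing (G i1 j) (G i1 j.+1)
    - \sum_(i0 <= i < i1) crossing (G i j1) (G i.+1 j1)
    - \sum_(j0 <= j < j1) crossing (G i0 j) (G i0 j.+1).
Proof.
move=> i01 j01.
pose H i j := crossing (G i j) (G i.+1 j).
pose V i j := crossing (G i j) (G i j.+1).
have E i j : cell_winding i j = (V i.+1 j - V i j) - (H i j.+1 - H i j).
  by rewrite /cell_winding -/(H i j) -/(V i.+1 j) -/(H i j.+1) -/(V i j); ring.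
under eq_bigr do under eq_bigr do rewrite E.
under eq_bigr do rewrite sumrB telescope_sumr //.
rewrite sumrB exchange_big /= sumrB.
under eq_bigr do rewrite telescope_sumr //.
by rewrite sumrB /H /V; ring.
Qed.

(** Since crossings in a half-plane form a coboundary, a polygonal path there counts like its
    chord. *)
Lemma sum_crossing_halfplane (p : nat -> R * R) n i0 i1 : (i0 <= i1)%N ->
  (forall i, (i0 <= i <= i1)%N -> 0 < n.1 * (p i).1 + n.2 * (p i).2) ->
  \sum_(i0 <= i < i1) crossing (p i) (p i.+1) = crossing (p i0) (p i1).
Proof.
move=> i01 h; rewrite (crossing_halfplane (n := n)) ?h ?i01 ?leqnn //.
rewrite (eq_big_nat _ _ (F2 := fun i =>
    if 0 < n.1 then upper (p i.+1) - upper (p i) else 0)); last first.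
  by move=> i /andP[h1 h2]; rewrite (crossing_halfplane (n := n)) ?h ?h1 ?h2 ?(ltnW h2) ?(leqW h1).
by case: ifP => _; rewrite ?telescope_sumr ?big1.
Qed.

Lemma cell_winding_halfplane n i j :
  (forall i' j', (i <= i' <= i.+1)%N -> (j <= j' <= j.+1)%N ->
     0 < n.1 * (G i' j').1 + n.2 * (G i' j').2) ->
  cell_winding i j = 0.
Proof.
move=> h; rewrite /cell_winding.
do 4!rewrite (crossing_halfplane (n := n)) ?h ?leqnn ?leqnSn //.
by case: ifP => _; ring.
Qed.

End Grid.

(** * The index sum of a planar field *)

(** Near each point of [K], a list with one element contains all of [S]; compactness merges these
    local lists into a single one. *)
Lemma compact_isolated_finite (T : topologicalType) (K S : set T) :
  compact K -> (forall x, K x -> \forall y \near x, S y -> y = x) ->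
  finite_set (K `&` S).
Proof.
move=> /compact_near_coveringP cK iso.
(* Finite lists directed by inclusion: a property is eventual if it holds for all lists containing
   some fixed one. *)
pose F := [set U : set (seq T) | exists l0 : seq T, forall l, {subset l0 <= l} -> U l].
have FF : Filter F.
  split=> [|U V [lU HU] [lV HV]|U V UV [l HU]]; first by exists [::].
    by exists (lU ++ lV) => l sub; split; [apply: HU|apply: HV] => x xl;
      apply: sub; rewrite mem_cat xl ?orbT.
  by exists l => l' /HU /UV.
have [|l Hl] := cK _ F (fun l x => S x -> x \in l) FF.
  move=> x Kx; exists ([set y | S y -> y = x], [set l : seq T | x \in l]) => /=.
    by split; [exact: iso|exists [:: x] => l; apply; rewrite inE].
  by move=> [y l] /= [Sy xl] /Sy ->.
apply: (sub_finite_set _ (finite_seq l)) => x [Kx Sx].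
by apply: (Hl l).
Qed.

Lemma small_all (R : realDomainType) (T : eqType) (Z : seq T) (p : T -> R -> Prop) :
  (forall z, z \in Z -> exists2 r, 0 < r & forall r', 0 < r' <= r -> p z r') ->
  exists2 r, 0 < r & forall z, z \in Z -> forall r', 0 < r' <= r -> p z r'.
Proof.
elim: Z => [_|z Z IH H]; first by exists 1.
have [r r0 pr] := H z (mem_head _ _).
have [|e e0 pe] := IH; first by move=> y yZ; apply: H; rewrite inE yZ orbT.
exists (Num.min r e) => [|y]; first by rewrite lt_min r0.
rewrite inE => /predU1P[->|yZ] x /andP[x0]; rewrite le_min => /andP[xr xe].
  by apply: pr; rewrite x0.
by apply: pe => //; rewrite x0.
Qed.

Section Planar.
Context {R : realType}.
Variables P Q : R -> R -> R.

(* The field is conjugate, by an invertible linear map, to a field (X, Y) that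
   is close to the radial one near z; D is the determinant of that map. *)
Definition radial_near (a b c d : R) (z : R * R) (r : R) :=
  forall s u, `|s - z.1| <= r -> `|u - z.2| <= r ->
  exists X Y, [/\ P s u = a * X + b * Y, Q s u = c * X + d * Y,
    `|X - (s - z.1)| <= (`|s - z.1| + `|u - z.2|) / 8 &
    `|Y - (u - z.2)| <= (`|s - z.1| + `|u - z.2|) / 8].

Definition regular_zero (z : R * R) (D : R) := exists a b c d,
  [/\ a * d - b * c = D, D != 0 & exists2 r, 0 < r & radial_near a b c d z r].

Lemma radial_near_le a b c d z r r' : r' <= r ->
  radial_near a b c d z r -> radial_near a b c d z r'.
Proof. by move=> rr' h s u hs hu; apply: h; apply: le_trans rr'. Qed.

(** At a zero, invertibility gives [X = Y = 0]; then each coordinate distance to [z] is at most an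
    eighth of their sum, so both vanish. *)
Lemma regular_zero_isolated z D : regular_zero z D ->
  exists2 r, 0 < r & forall s u, `|s - z.1| <= r -> `|u - z.2| <= r ->
    P s u = 0 -> Q s u = 0 -> (s, u) = z.
Proof.
move=> [a [b [c [d [E D0 [r r0 h]]]]]]; exists r => // s u hs hu p0 q0.
have [X [Y [EP EQ hX hY]]] := h _ _ hs hu.
rewrite p0 in EP; rewrite q0 in EQ.
have X0 : X = 0.
  apply: (mulfI D0); rewrite -E mulr0.
  by transitivity (d * (a * X + b * Y) - b * (c * X + d * Y)); [ring|rewrite -EP -EQ; ring].
have Y0 : Y = 0.
  apply: (mulfI D0); rewrite -E mulr0.
  by transitivity (a * (c * X + d * Y) - c * (a * X + b * Y)); [ring|rewrite -EP -EQ; ring].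
move: hX hY; rewrite X0 Y0 !sub0r !normrN => hX hY.
have h1 : `|s - z.1| = 0 by have := normr_ge0 (s - z.1); have := normr_ge0 (u - z.2); lra.
have h2 : `|u - z.2| = 0 by have := normr_ge0 (s - z.1); have := normr_ge0 (u - z.2); lra.
move/normr0_eq0/eqP : h1; move/normr0_eq0/eqP : h2.
by rewrite !subr_eq0 => /eqP-> /eqP->; case: z {h hs hu hX hY}.
Qed.

(** On each side of the block one coordinate is at least [r / 2] away from [z], while the errors are
    at most [r / 4]. So each side stays in a half-plane and may be replaced by its chord, and the
    corners are images of points in the four quadrants. *)
Lemma block_winding a b c d z r (x y : nat -> R) i0 i1 j0 j1 :
  a * d - b * c != 0 -> 0 < r -> radial_near a b c d z r ->
  {homo x : i j / (i <= j)%N >-> i <= j} -> {homo y : i j / (i <= j)%N >-> i <= j} ->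
  (i0 <= i1)%N -> (j0 <= j1)%N ->
  z.1 - r <= x i0 <= z.1 - r / 2 -> z.1 + r / 2 <= x i1 <= z.1 + r ->
  z.2 - r <= y j0 <= z.2 - r / 2 -> z.2 + r / 2 <= y j1 <= z.2 + r ->
  \sum_(i0 <= i < i1) \sum_(j0 <= j < j1)
     cell_winding (fun i j => (P (x i) (y j), Q (x i) (y j))) i j = sgz (a * d - b * c).
Proof.
move=> D0 r0 h mx my i01 j01 /andP[x0 x0'] /andP[x1 x1'] /andP[y0 y0'] /andP[y1 y1'].
set D := a * d - b * c in D0 *.
have near i j : (i0 <= i <= i1)%N -> (j0 <= j <= j1)%N ->
  exists X Y, [/\ P (x i) (y j) = a * X + b * Y, Q (x i) (y j) = c * X + d * Y,
    `|X - (x i - z.1)| <= r / 4 & `|Y - (y j - z.2)| <= r / 4].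
  move=> /andP[/mx a1 /mx a2] /andP[/my a3 /my a4].
  have hs : `|x i - z.1| <= r by rewrite ler_norml; lra.
  have hu : `|y j - z.2| <= r by rewrite ler_norml; lra.
  have [X [Y [e1 e2 e3 e4]]] := h _ _ hs hu.
  by exists X, Y; split => //; lra.
have side i j : (i0 <= i <= i1)%N -> (j0 <= j <= j1)%N ->
  let p := (P (x i) (y j), Q (x i) (y j)) in
  [/\ y j <= z.2 - r / 2 -> 0 < (c / D) * p.1 + (- a / D) * p.2,
      z.2 + r / 2 <= y j -> 0 < (- c / D) * p.1 + (a / D) * p.2,
      x i <= z.1 - r / 2 -> 0 < (- d / D) * p.1 + (b / D) * p.2 &
      z.1 + r / 2 <= x i -> 0 < (d / D) * p.1 + (- b / D) * p.2].
  move=> hi hj /=; have [X [Y [-> ->]]] := near _ _ hi hj.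
  rewrite !ler_norml => /andP[h1 h2] /andP[h3 h4].
  have EX : (d / D) * (a * X + b * Y) + (- b / D) * (c * X + d * Y) = X.
    by transitivity (D / D * X); [rewrite /D; ring | rewrite divff // mul1r].
  have EY : (- c / D) * (a * X + b * Y) + (a / D) * (c * X + d * Y) = Y.
    by transitivity (D / D * Y); [rewrite /D; ring | rewrite divff // mul1r].
  have EX' : (- d / D) * (a * X + b * Y) + (b / D) * (c * X + d * Y) = - X by rewrite -[in RHS]EX; ring.
  have EY' : (c / D) * (a * X + b * Y) + (- a / D) * (c * X + d * Y) = - Y by rewrite -[in RHS]EY; ring.
  by rewrite EX EY EX' EY'; split=> ?; lra.
rewrite sum_cell_winding //.
have ii0 : (i0 <= i0 <= i1)%N by rewrite leqnn.
have ii1 : (i0 <= i1 <= i1)%N by rewrite i01 leqnn.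
have jj0 : (j0 <= j0 <= j1)%N by rewrite leqnn.
have jj1 : (j0 <= j1 <= j1)%N by rewrite j01 leqnn.
(* Rows of the inverse map and their negatives: on the field these functionals return [- Y], [Y],
   [- X] and [X], each positive on one side of the block. *)
pose n1 : R * R := (c / D, - a / D); pose n2 : R * R := (- c / D, a / D).
pose n3 : R * R := (- d / D, b / D); pose n4 : R * R := (d / D, - b / D).
rewrite (sum_crossing_halfplane (p := fun i => (P (x i) (y j0), Q (x i) (y j0))) (n := n1)) //; last first.
  by move=> i hi; have [+ _ _ _] := side _ _ hi jj0; exact.
rewrite (sum_crossing_halfplane (p := fun i => (P (x i) (y j1), Q (x i) (y j1))) (n := n2)) //; last first.
  by move=> i hi; have [_ + _ _] := side _ _ hi jj1; exact.
rewrite (sum_crossing_halfplane (p := fun j => (P (x i0) (y j), Q (x i0) (y j))) (n := n3)) //; last first.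
  by move=> i hi; have [_ _ + _] := side _ _ ii0 hi; exact.
rewrite (sum_crossing_halfplane (p := fun j => (P (x i1) (y j), Q (x i1) (y j))) (n := n4)) //; last first.
  by move=> i hi; have [_ _ _ +] := side _ _ ii1 hi; exact.
have [X1 [Y1 [-> ->]]] := near _ _ ii0 jj0; rewrite !ler_norml => /andP[? ?] /andP[? ?].
have [X2 [Y2 [-> ->]]] := near _ _ ii1 jj0; rewrite !ler_norml => /andP[? ?] /andP[? ?].
have [X3 [Y3 [-> ->]]] := near _ _ ii1 jj1; rewrite !ler_norml => /andP[? ?] /andP[? ?].
have [X4 [Y4 [-> ->]]] := near _ _ ii0 jj1; rewrite !ler_norml => /andP[? ?] /andP[? ?].
by apply: crossing_quadrants => //; lra.
Qed.

Definition lipschitz2 (L : R) (f : R -> R -> R) :=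
  forall s u s' u', `|f s u - f s' u'| <= L * (`|s - s'| + `|u - u'|).

(** Compactness, with [m] tending to 0 from the right: near a zero no point is far from [Z], and
    near any other point the Lipschitz bounds preserve half the size of the field. *)
Lemma field_lower_bound L (Z : seq (R * R)) a b c d r : 0 <= L ->
  lipschitz2 L P -> lipschitz2 L Q -> 0 < r ->
  (forall s u, a <= s <= b -> c <= u <= d -> P s u = 0 -> Q s u = 0 -> (s, u) \in Z) ->
  exists2 m, 0 < m & forall s u, a <= s <= b -> c <= u <= d ->
    (forall z, z \in Z -> r <= `|s - z.1| \/ r <= `|u - z.2|) ->
    m <= `|P s u| + `|Q s u|.
Proof.
move=> L0 LP LQ r0 HZ.
have cK : compact (`[a, b]%classic `*` `[c, d]%classic).
  by apply: compact_setX; exact: segment_compact.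
move/compact_near_coveringP : cK.
pose good (m : R) (x : R * R) := (forall z, z \in Z -> r <= `|x.1 - z.1| \/ r <= `|x.2 - z.2|) ->
    m <= `|P x.1 x.2| + `|Q x.1 x.2|.
move=> /(_ R (0^'+) good _)[].
  move=> [s u] [/=]; rewrite !in_itv /= => hs hu.
  have [/andP[/eqP p0 /eqP q0]|pq] := boolP ((P s u == 0) && (Q s u == 0)).
    have zZ := HZ _ _ hs hu p0 q0.
    exists (ball (s, u) r, setT) => /=; first by split; [exact: nbhsx_ballx|exact: filterT].
    move=> [x m] /= [[/= b1 b2] _] /(_ _ zZ) /= hg; exfalso.
    move: b1 b2; rewrite /ball /= (distrC s) (distrC u) => b1 b2.
    by case: hg; lra.
  set e := `|P s u| + `|Q s u|.
  have e0 : 0 < e.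
    move: pq; rewrite negb_and -!normr_gt0 /e => /orP[] ?;
    have := normr_ge0 (P s u); have := normr_ge0 (Q s u); lra.
  pose dl := e / (8 * (L + 1)).
  have L1 : 0 < 8 * (L + 1) by lra.
  have dl0 : 0 < dl by rewrite divr_gt0.
  have dlE : 8 * (L + 1) * dl = e by rewrite /dl mulrC divfK // gt_eqF.
  exists (ball (s, u) dl, [set m | m < e / 2]) => /=.
    split; first exact: nbhsx_ballx.
    apply: nbhs_right_lt; lra.
  move=> [[s' u'] m] /= [[/= b1 b2] me] _.
  rewrite /ball /= in b1 b2.
  have h1 := LP s u s' u'; have h2 := LQ s u s' u'.
  have h3 := lerB_dist (P s u) (P s' u').
  have h4 := lerB_dist (Q s u) (Q s' u').
  have h5 : L * (`|s - s'| + `|u - u'|) <= L * (2 * dl) by rewrite ler_wpM2l //; lra.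
  rewrite -/e in dlE *; have : L * (2 * dl) <= e / 4 by nra.
  rewrite /e in me *; lra.
move=> d0 /= d00 hd; exists (d0 / 2); first by lra.
move=> s u hs hu hg.
apply: (hd (d0 / 2)) (s, u) _ hg => /=; last by rewrite !in_itv.
  by rewrite sub0r normrN gtr0_norm; lra.
lra.
Qed.

Lemma grid_index (h a x : R) : 0 < h -> a <= x ->
  exists i : nat, a + i%:R * h <= x < a + i.+1%:R * h.
Proof.
move=> h0 ax; exists (Num.truncn ((x - a) / h)).
have /Num.Theory.truncn_itv : 0 <= (x - a) / h by rewrite divr_ge0 ?subr_ge0 // ltW.
by rewrite ler_pdivlMr // ltr_pdivrMr // => /andP[h1 h2]; apply/andP; split; lra.
Qed.

End Planar.

(** A cell lies in at most one block, so [F] is the sum of its restrictions to the blocks, and the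
    sums can be exchanged. *)
Lemma sum_blocks (T : eqType) (Z : seq T) (n : nat) (F : nat -> nat -> int)
    (i0 i1 j0 j1 : T -> nat) :
  uniq Z -> (forall z, z \in Z -> (i1 z <= n)%N /\ (j1 z <= n)%N) ->
  (forall z z' i j, z \in Z -> z' \in Z -> (i0 z <= i < i1 z)%N -> (j0 z <= j < j1 z)%N ->
     (i0 z' <= i < i1 z')%N -> (j0 z' <= j < j1 z')%N -> z = z') ->
  (forall i j, (i < n)%N -> (j < n)%N ->
     (forall z, z \in Z -> ~~ ((i0 z <= i < i1 z)%N && (j0 z <= j < j1 z)%N)) -> F i j = 0) ->
  \sum_(0 <= i < n) \sum_(0 <= j < n) F i j =
  \sum_(z <- Z) \sum_(i0 z <= i < i1 z) \sum_(j0 z <= j < j1 z) F i j.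
Proof.
move=> uZ hn dis zero.
pose B z i j := (i0 z <= i < i1 z)%N && (j0 z <= j < j1 z)%N.
transitivity (\sum_(0 <= i < n) \sum_(0 <= j < n) \sum_(z <- Z) if B z i j then F i j else 0).
  rewrite !big_mkord; apply: eq_bigr => i _; rewrite !big_mkord; apply: eq_bigr => j _.
  have [/hasP[z zZ Bz]|/hasPn nB] := boolP (has (fun z => B z i j) Z).
    rewrite (bigD1_seq z) //= Bz big_seq_cond big1 ?addr0 // => z' /andP[z'Z z'z].
    case: ifP => // /andP[b1 b2]; case/andP: Bz => b3 b4.
    by rewrite (dis z' z i j) ?eqxx in z'z.
  rewrite zero // big_seq_cond big1 // => z; rewrite andbT => /nB.
  by rewrite -/(B z i j) => /negbTE->.
under eq_bigr do rewrite exchange_big.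
rewrite exchange_big /=; apply: eq_big_seq => z /hn[n1 n2].
have widen m k (f : nat -> int) : (k <= n)%N ->
    \sum_(m <= i < k) f i = \sum_(0 <= i < n) if (m <= i < k)%N then f i else 0.
  move=> kn; rewrite (big_nat_widen _ _ _ _ _ kn) (big_nat_widenl _ 0) // big_mkcond.
  by apply: eq_bigr => i _; rewrite /= andbC.
rewrite (widen _ _ _ n1); apply: eq_bigr => i _.
case: ifP => hi; last by rewrite big1 // => j _; rewrite /B hi.
by rewrite (widen _ _ _ n2); apply: eq_bigr => j _; rewrite /B hi.
Qed.

(** The Poincare-Hopf theorem for a field pointing outwards at both boundary circles. The total
    winding of the grid vanishes: the vertical sides cancel by periodicity and the horizontal ones
    miss the half-axis. Only the blocks around the zeros contribute, each by the sign of its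
    [D z]. *)
Lemma index_sum_annulus (R : realType) (P Q : R -> R -> R) (L a c d : R) (Z : seq (R * R)) (D : R * R -> R) :
  0 <= L -> lipschitz2 L P -> lipschitz2 L Q -> c < d ->
  (forall u, P (a + 1) u = P a u) -> (forall u, Q (a + 1) u = Q a u) ->
  (forall s, Q s c < 0) -> (forall s, 0 < Q s d) ->
  uniq Z ->
  (forall z, z \in Z -> [/\ regular_zero P Q z (D z), a < z.1 < a + 1 & c < z.2 < d]) ->
  (forall s u, a <= s <= a + 1 -> c <= u <= d -> P s u = 0 -> Q s u = 0 -> (s, u) \in Z) ->
  \sum_(z <- Z) sgz (D z) = 0.
Proof.
move=> L0 LP LQ cd perP perQ Qc Qd uZ HZ Hz.
(* The squares of half-side [r] around the zeros lie in the annulus, are disjoint, and [radial_near]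
   holds on them. *)
have [r r0 Hr] : exists2 r : R, 0 < r & forall z, z \in Z ->
    [/\ exists a' b' c' d', [/\ a' * d' - b' * c' = D z, D z != 0 & radial_near P Q a' b' c' d' z r],
     a <= z.1 - r /\ z.1 + r <= a + 1, c <= z.2 - r /\ z.2 + r <= d &
     forall z', z' \in Z -> z' <> z -> 2 * r < `|z.1 - z'.1| \/ 2 * r < `|z.2 - z'.2|].
  have [|r r0 Hr] := small_all (Z := Z) (p := fun z r =>
     [/\ exists a' b' c' d', [/\ a' * d' - b' * c' = D z, D z != 0 & radial_near P Q a' b' c' d' z r],
     a <= z.1 - r /\ z.1 + r <= a + 1, c <= z.2 - r /\ z.2 + r <= d &
     forall z', z' \in Z -> z' <> z -> 2 * r < `|z.1 - z'.1| \/ 2 * r < `|z.2 - z'.2|]); last first.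
    by exists r => // z zZ; apply: (Hr z zZ r); rewrite r0 lexx.
  move=> z zZ; have [[a' [b' [c' [d' [DE D0 [r r0 hr]]]]]] hz1 hz2] := HZ z zZ.
  have [|e e0 He] := small_all (Z := Z) (p := fun z' r => z' <> z -> 2 * r < `|z.1 - z'.1| \/ 2 * r < `|z.2 - z'.2|).
    move=> z' z'Z; have [->|zz'] := eqVneq z' z; first by exists 1.
    pose m := Num.max `|z.1 - z'.1| `|z.2 - z'.2|.
    have m0 : 0 < m.
      rewrite lt_max !normr_gt0 !subr_eq0 -negb_and; apply: contra zz' => /andP[/eqP h1 /eqP h2].
      by case: (z) (z') h1 h2 => [? ?] [? ?] /= -> ->.
    exists (m / 4); first lra.
    move=> e /andP[e0 em] _.
    have : m <= `|z.1 - z'.1| \/ m <= `|z.2 - z'.2|.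
      by rewrite /m; case: (leP `|z.1 - z'.1| `|z.2 - z'.2|) => _; [right|left].
    by case=> ?; [left|right]; lra.
  pose t := Num.min (Num.min r e) (Num.min (Num.min (z.1 - a) (a + 1 - z.1)) (Num.min (z.2 - c) (d - z.2))).
  exists t; first by rewrite /t !lt_min; lra.
  move=> x /andP[x0]; rewrite /t !le_min => /andP[/andP[xr xe] /andP[/andP[x1 x2] /andP[x3 x4]]].
  split; [|split; lra|split; lra|].
    by exists a', b', c', d'; split => //; apply: radial_near_le hr.
  by move=> z' z'Z; apply: (He z' z'Z); rewrite x0.
have r20 : 0 < r / 2 by lra.
have [m m0 Hm] := field_lower_bound L0 LP LQ r20 Hz.
have d_c : 0 < d - c by lra.
(* The mesh: the first bound makes grid lines fall into the windows of width [r / 2] that delimit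
   the blocks, the second makes the field vary by at most [m / 4] over a cell. *)
pose rho := Num.min (r / 2) (m / (4 * (L + 1))).
have L1 : 0 < 4 * (L + 1) by lra.
have rho0 : 0 < rho by rewrite lt_min r20 divr_gt0.
have [n n0 nrho] : exists2 n : nat, (0 < n)%N & (1 + (d - c)) / n%:R <= rho.
  exists (Num.Def.archi_bound ((1 + (d - c)) / rho)).+1 => //.
  rewrite ler_pdivrMr ?ltr0n // mulrC -ler_pdivrMr //.
  apply/ltW; apply: lt_trans (archi_boundP _) _; first by rewrite divr_ge0 // ltW //; lra.
  by rewrite ltr_nat.
have nR : 0 < n%:R :> R by rewrite ltr0n.
pose h : R := n%:R^-1; pose k := (d - c) / n%:R.
have h0 : 0 < h by rewrite invr_gt0.
have k0 : 0 < k by rewrite divr_gt0.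
have hkr : h + k <= rho by move: nrho; rewrite mulrDl mul1r.
have hk : h + k <= r / 2 by apply: le_trans hkr _; rewrite ge_min lexx.
have Lhk : L * (h + k) <= m / 4.
  have : (h + k) * (4 * (L + 1)) <= m.
    by rewrite -ler_pdivlMr //; apply: le_trans hkr _; rewrite ge_min lexx orbT.
  nra.
pose x (i : nat) := a + i%:R * h; pose y (j : nat) := c + j%:R * k.
have mx : {homo x : i j / (i <= j)%N >-> i <= j}.
  by move=> i j ij; rewrite lerD2l ler_wpM2r ?ler_nat // ltW.
have my : {homo y : i j / (i <= j)%N >-> i <= j}.
  by move=> i j ij; rewrite lerD2l ler_wpM2r ?ler_nat // ltW.
have x0E : x 0%N = a by rewrite /x mul0r addr0.
have y0E : y 0%N = c by rewrite /y mul0r addr0.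
have xnE : x n = a + 1 by rewrite /x /h mulfV // gt_eqF.
have ynE : y n = d by rewrite /y /k mulrC divfK ?gt_eqF // addrC subrK.
pose G i j := (P (x i) (y j), Q (x i) (y j)).
have idx z : z \in Z -> exists i0 i1 j0 j1, [/\
   z.1 - r <= x i0 <= z.1 - r / 2, z.1 + r / 2 <= x i1 <= z.1 + r,
   z.2 - r <= y j0 <= z.2 - r / 2 & z.2 + r / 2 <= y j1 <= z.2 + r].
  move=> zZ; have [_ [z1 z2] [z3 z4] _] := Hr z zZ.
  have [|i0 /andP[h1 h2]] := @grid_index _ h a (z.1 - r / 2) h0; first lra.
  have [|i1 /andP[h3 h4]] := @grid_index _ h a (z.1 + r / 2) h0; first lra.
  have [|j0 /andP[h5 h6]] := @grid_index _ k c (z.2 - r / 2) k0; first lra.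
  have [|j1 /andP[h7 h8]] := @grid_index _ k c (z.2 + r / 2) k0; first lra.
  (* The lower index is the last grid line up to [- r / 2], the upper one the first beyond
     [+ r / 2], hence the successors. *)
  exists i0, i1.+1, j0, j1.+1; rewrite /x /y; move: h2 h4 h6 h8; rewrite -(natr1 i0) -(natr1 i1) -(natr1 j0) -(natr1 j1).
  by move=> ? ? ? ?; split; lra.
have lt_x i j : x i < x j -> (i < j)%N by move=> xx; rewrite ltnNge; apply/negP => /mx; rewrite leNgt xx.
have lt_y i j : y i < y j -> (i < j)%N by move=> xx; rewrite ltnNge; apply/negP => /my; rewrite leNgt xx.
have lt_x' i : x i < a + 1 + h -> (i <= n)%N.
  move=> xi; rewrite -ltnS; apply: lt_x; rewrite /x -natr1 mulrDl mul1r.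
  by rewrite -/(x n) addrA -/(x n) xnE.
have lt_y' i : y i < d + k -> (i <= n)%N.
  move=> xi; rewrite -ltnS; apply: lt_y; rewrite /y -natr1 mulrDl mul1r.
  by rewrite addrA -/(y n) ynE.
have zero : \sum_(0 <= i < n) \sum_(0 <= j < n) cell_winding G i j = 0.
  rewrite sum_cell_winding // big_nat big1 => [|i _]; last first.
    have q1 : Q (x i) c < 0 := Qc _; have q2 : Q (x i.+1) c < 0 := Qc _.
    by rewrite /crossing /G /= y0E !leNgt q1 q2 /=.
  rewrite [X in _ - X - _]big1 => [|i _]; last first.
    have q1 := Qd (x i); have q2 := Qd (x i.+1).
    by rewrite /crossing /G /= ynE !ltNge (ltW q1) (ltW q2).
  rewrite add0r subr0; apply/eqP; rewrite subr_eq0; apply/eqP; apply: eq_bigr => j _.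
  by rewrite /G xnE x0E !perP !perQ.
have [i0 [i1 [j0 [j1 HI]]]] : exists i0 i1 j0 j1 : R * R -> nat, forall z, z \in Z -> [/\
   z.1 - r <= x (i0 z) <= z.1 - r / 2, z.1 + r / 2 <= x (i1 z) <= z.1 + r,
   z.2 - r <= y (j0 z) <= z.2 - r / 2 & z.2 + r / 2 <= y (j1 z) <= z.2 + r].
  (* The default quadruple outside [Z] makes the four indices total functions of [z]. *)
  have idx' z : exists q : nat * nat * nat * nat, z \in Z -> [/\
   z.1 - r <= x q.1.1.1 <= z.1 - r / 2, z.1 + r / 2 <= x q.1.1.2 <= z.1 + r,
   z.2 - r <= y q.1.2 <= z.2 - r / 2 & z.2 + r / 2 <= y q.2 <= z.2 + r].
    have [zZ|] := boolP (z \in Z); last by exists (0, 0, 0, 0)%N.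
    by have [k0' [k1 [k2 [k3 Hk]]]] := idx z zZ; exists (k0', k1, k2, k3).
  have [q Hq] := choice idx'.
  by exists (fun z => (q z).1.1.1), (fun z => (q z).1.1.2), (fun z => (q z).1.2), (fun z => (q z).2).
rewrite -[RHS]zero (sum_blocks (Z := Z) (i0 := i0) (i1 := i1) (j0 := j0) (j1 := j1)) //.
- apply: eq_big_seq => z zZ.
  have [[a' [b' [c' [d' [DE D0 hr]]]]] _ _ _] := Hr z zZ.
  have [h1 h2 h3 h4] := HI z zZ.
  rewrite -DE; rewrite -DE in D0.
  by symmetry; apply: (block_winding D0 r0 hr) => //; apply/ltnW; [apply: lt_x|apply: lt_y]; lra.
- move=> z zZ; have [h1 h2 h3 h4] := HI z zZ; have [_ z1 z2 _] := Hr z zZ.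
  by split; [apply: lt_x'; lra|apply: lt_y'; lra].
- move=> z z' i j zZ z'Z /andP[/mx a1 /mx a2] /andP[/my a3 /my a4] /andP[/mx a5 /mx a6] /andP[/my a7 /my a8].
  apply: contrapT => zz'; have [_ _ _ dis] := Hr _ zZ.
  have [h1 h2 h3 h4] := HI z zZ; have [h5 h6 h7 h8] := HI z' z'Z.
  have Ex : x i.+1 = x i + h by rewrite /x -natr1; ring.
  have Ey : y j.+1 = y j + k by rewrite /y -natr1; ring.
  rewrite Ex in a2 a6; rewrite Ey in a4 a8.
  have n1 : `|z.1 - z'.1| <= 2 * r by rewrite ler_norml; lra.
  have n2 : `|z.2 - z'.2| <= 2 * r by rewrite ler_norml; lra.
  by case: (dis _ z'Z (nesym zz')); lra.
move=> i j ilt jlt nB.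
have xi := mx _ _ (ltnW ilt); have yj := my _ _ (ltnW jlt).
have xi' := mx _ _ (leq0n i); have yj' := my _ _ (leq0n j).
rewrite x0E in xi'; rewrite y0E in yj'; rewrite xnE in xi; rewrite ynE in yj.
(* Blocks reach at least [r / 2] from their zeros on all sides, so the lower left corner of a cell
   outside them is far from [Z]. *)
have far : forall z, z \in Z -> r / 2 <= `|x i - z.1| \/ r / 2 <= `|y j - z.2|.
  move=> z zZ; have := nB z zZ; have [h1 h2 h3 h4] := HI z zZ.
  rewrite negb_and !negb_and -!ltnNge !ltnS => /orP[]/orP[lt|lt].
  - by left; have := mx _ _ (ltnW lt); rewrite ler_normr => ?; apply/orP; right; lra.
  - by left; have := mx _ _ lt; rewrite ler_normr => ?; apply/orP; left; lra.
  - by right; have := my _ _ (ltnW lt); rewrite ler_normr => ?; apply/orP; right; lra.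
  - by right; have := my _ _ lt; rewrite ler_normr => ?; apply/orP; left; lra.
have := Hm (x i) (y j) _ _ far; rewrite xi xi' yj yj' => /(_ isT isT) Hmm.
(* The field at the lower left corner is the normal of a half-plane: its absolute values sum to at
   least [m], and each component varies by at most [m / 4] over the cell. *)
apply: (@cell_winding_halfplane _ _ (G i j)) => i' j' /andP[i1' i2'] /andP[j1' j2'].
have dx : `|x i - x i'| <= h.
  have := mx _ _ i1'; have := mx _ _ i2'; rewrite {2}/x -natr1 mulrDl mul1r addrA -/(x i).
  by rewrite ler_norml; lra.
have dy : `|y j - y j'| <= k.
  have := my _ _ j1'; have := my _ _ j2'; rewrite {2}/y -natr1 mulrDl mul1r addrA -/(y j).
  by rewrite ler_norml; lra.
have LL : L * (`|x i - x i'| + `|y j - y j'|) <= m / 4.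
  by apply: le_trans Lhk; rewrite ler_wpM2l // lerD.
have := le_trans (LP _ _ _ _) LL; have := le_trans (LQ _ _ _ _) LL.
rewrite /G /=; move: Hmm.
move: (P (x i) (y j)) (P (x i') (y j')) (Q (x i) (y j)) (Q (x i') (y j')).
move: m0; clear; move=> m0 p p' q q' hm hq hp.
have e1 : p * p' + q * q' = (`|p| ^+ 2 + `|q| ^+ 2) - (p * (p - p') + q * (q - q')).
  by rewrite !real_normK ?num_real //; ring.
have e2 : p * (p - p') <= `|p| * (m / 4).
  by apply: le_trans (ler_norm _) _; rewrite normrM ler_wpM2l.
have e3 : q * (q - q') <= `|q| * (m / 4).
  by apply: le_trans (ler_norm _) _; rewrite normrM ler_wpM2l.
rewrite e1; have := normr_ge0 p; have := normr_ge0 q.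
move: `|p| `|q| hm e2 e3 {e1 hp hq} => A B hm e2 e3 B0 A0.
have : (A + B) ^+ 2 <= 2 * (A ^+ 2 + B ^+ 2) by have := sqr_ge0 (A - B); nra.
nra.
Qed.

(** * Calculus of the Lorentz form along curves *)

Section FormCalculus.
Context {R : realType}.
Local Notation form := (@spacelike_form R).

Lemma is_derive_entry (f : R -> 'rV[R]_3) t i : derivable f t 1 ->
  is_derive t 1 (fun s => f s 0 i) (derive1 f t 0 i).
Proof.
move=> df; rewrite derive1E derive_mx // mxE.
by apply: DeriveDef => //; move/derivable_mxP: df.
Qed.

Lemma is_diff_fst_comp (x : R -> R) (p : R * R) dx : is_derive p.1 1 x dx ->
  is_diff p (fun q : R * R => x q.1) (fun v => v.1 * dx).
Proof.
move=> dx1; have df : differentiable x p.1 by apply/derivable1_diffP.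
have dfst : differentiable (fst : R * R -> R) p.
  by apply: linear_differentiable; move=> z; exact: cvg_fst.
have -> : (fun q : R * R => x q.1) = x \o fst by [].
apply: DiffDef; first exact: differentiable_comp.
rewrite diff_comp // diff1E //; apply/funext => v /=.
rewrite diff_lin /=; last by move=> z; exact: cvg_fst.
by rewrite derive1E derive_val.
Qed.

Lemma is_diff_snd_comp (x : R -> R) (p : R * R) dx : is_derive p.2 1 x dx ->
  is_diff p (fun q : R * R => x q.2) (fun v => v.2 * dx).
Proof.
move=> dx1; have df : differentiable x p.2 by apply/derivable1_diffP.
have dsnd : differentiable (snd : R * R -> R) p.
  by apply: linear_differentiable; move=> z; exact: cvg_snd.
have -> : (fun q : R * R => x q.2) = x \o snd by [].
apply: DiffDef; first exact: differentiable_comp.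
rewrite diff_comp // diff1E //; apply/funext => v /=.
rewrite diff_lin /=; last by move=> z; exact: cvg_snd.
by rewrite derive1E derive_val.
Qed.

Lemma is_diff_form (f h : R -> 'rV[R]_3) (p : R * R) :
  derivable f p.1 1 -> derivable h p.2 1 ->
  is_diff p (fun q : R * R => form (f q.1) (h q.2))
    (fun v => v.1 * form (derive1 f p.1) (h p.2) + v.2 * form (f p.1) (derive1 h p.2)).
Proof.
move=> df dh.
have e i := is_diff_fst_comp (is_derive_entry i df).
have e' i := is_diff_snd_comp (is_derive_entry i dh).
have m i := is_diffM (e i) (e' i).
have := is_diffB (is_diffD (m 0) (m 1)) (m 2).
move=> H; apply: (is_diff_eq H).
by apply/funext => v; rewrite /spacelike_form /= !fctE /GRing.scale /=; ring.
Qed.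

Lemma derive_form (f h : R -> 'rV[R]_3) (p v : R * R) :
  derivable f p.1 1 -> derivable h p.2 1 ->
  'D_v (fun q : R * R => form (f q.1) (h q.2)) p =
    v.1 * form (derive1 f p.1) (h p.2) + v.2 * form (f p.1) (derive1 h p.2).
Proof.
move=> df dh; have H := is_diff_form df dh.
by rewrite deriveE ?diff_val.
Qed.

Lemma form_first_order (f h : R -> 'rV[R]_3) (p : R * R) (k : R) :
  derivable f p.1 1 -> derivable h p.2 1 -> 0 < k ->
  exists2 r : R, 0 < r & forall s t, `|s - p.1| <= r -> `|t - p.2| <= r ->
    `|form (f s) (h t) - form (f p.1) (h p.2)
      - ((s - p.1) * form (derive1 f p.1) (h p.2) + (t - p.2) * form (f p.1) (derive1 h p.2))|
    <= k * (`|s - p.1| + `|t - p.2|).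
Proof.
move=> df dh k0; have H := is_diff_form df dh.
have dF : differentiable (fun q : R * R => form (f q.1) (h q.2)) p by [].
have /diff_locally/eqaddoP/(_ _ k0) := dF.
case=> U [/= /nbhs_normP[r1 r10 h1] /nbhs_normP[r2 r20 h2]] Hr.
rewrite /= in r10 r20.
pose r := Num.min r1 r2; have r0 : 0 < r by rewrite lt_min r10.
exists (r / 2); first by rewrite divr_gt0.
move=> s t hs ht; have rr2 : r / 2 < r by lra.
have [rr1 rr3] : r <= r1 /\ r <= r2 by rewrite /r !ge_min !lexx orbT.
have /Hr : (U.1 `*` U.2) (s - p.1, t - p.2).
  by split; [apply: h1|apply: h2]; rewrite /ball_ /= sub0r normrN;
  [apply: le_lt_trans hs _; apply: lt_le_trans rr1|apply: le_lt_trans ht _; apply: lt_le_trans rr3].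
rewrite /= !fctE /= diff_val /= !subrK => Hle.
rewrite -addrA -opprD; apply: (le_trans Hle); rewrite ler_wpM2l ?(ltW k0) // prod_normE /=.
by rewrite ge_max lerDl lerDr !normr_ge0.
Qed.

Lemma is_derive_form (f h : R -> 'rV[R]_3) t :
  derivable f t 1 -> derivable h t 1 ->
  is_derive t 1 (fun s => form (f s) (h s))
    (form (derive1 f t) (h t) + form (f t) (derive1 h t)).
Proof.
move=> df dh.
have e i := is_derive_entry i df.
have e' i := is_derive_entry i dh.
have m i := is_deriveM (e i) (e' i).
have H := is_deriveB (is_deriveD (m 0) (m 1)) (m 2).
apply: (is_derive_eq H).
by rewrite /spacelike_form /GRing.scale /=; ring.
Qed.

Lemma formC u v : form u v = form v u.
Proof. by rewrite /spacelike_form; ring. Qed.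

Lemma formZl a u v : form (a *: u) v = a * form u v.
Proof. by rewrite /spacelike_form !mxE; ring. Qed.

Lemma formZr a u v : form u (a *: v) = a * form u v.
Proof. by rewrite /spacelike_form !mxE; ring. Qed.

Lemma form0r u : form u 0 = 0.
Proof. by rewrite /spacelike_form !mxE !mulr0 subr0 addr0. Qed.

Lemma formNl u v : form (- u) v = - form u v.
Proof. by rewrite /spacelike_form !mxE; ring. Qed.

Lemma formNr u v : form u (- v) = - form u v.
Proof. by rewrite /spacelike_form !mxE; ring. Qed.

End FormCalculus.

(** * Periodic functions on the line *)

Section Periodic.
Context {R : realType}.

Lemma periodic_natr (T : Type) (f : R -> T) : (forall t, f (t + 1) = f t) ->
  forall (n : nat) t, f (t + n%:R) = f t.
Proof.
move=> per; elim=> [|n IH] t; first by rewrite addr0.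
by rewrite -natr1 addrA per IH.
Qed.

Lemma periodic_intr (T : Type) (f : R -> T) : (forall t, f (t + 1) = f t) ->
  forall (n : int) t, f (t + n%:~R) = f t.
Proof.
move=> per [n|n] t; first exact: periodic_natr.
by rewrite NegzE mulrNz -[in RHS](subrK n.+1%:R t) periodic_natr.
Qed.

Lemma circle_rep (t : R) : exists2 t' : R, circle t' & exists n : int, t = t' + n%:~R.
Proof.
exists (t - (Num.floor t)%:~R); last by exists (Num.floor t); rewrite subrK.
have /andP[h1 h2] := floor_itv t.
by rewrite /circle /=; move: h2; rewrite intrD; lra.
Qed.

Lemma derivable_continuous (V : normedModType R) (f : R -> V) : (forall t, derivable f t 1) -> continuous f.
Proof. by move=> df t; apply: differentiable_continuous; apply/derivable1_diffP. Qed.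

Lemma periodic_max (x : R -> R) : continuous x -> (forall t, x (t + 1) = x t) ->
  exists s, forall t, x t <= x s.
Proof.
move=> cx per; have [|s _ Hs] := @EVT_max R x 0 1 ler01.
  exact: continuous_subspaceT.
exists s => t; have [t' /= /andP[h1 h2] [n ->]] := circle_rep t.
by rewrite periodic_intr //; apply: Hs; rewrite in_itv /= h1 ltW.
Qed.

Lemma periodic_bounded (x : R -> R) : continuous x -> (forall t, x (t + 1) = x t) ->
  exists2 M, 0 <= M & forall t, `|x t| <= M.
Proof.
move=> cx per; have [||s Hs] := @periodic_max (fun t => `|x t|).
- by move=> t; apply: continuous_comp; [exact: cx | exact: norm_continuous].
- by move=> t; rewrite per.
by exists `|x s|.
Qed.

Lemma derivative_bound_lipschitz (x dx : R -> R) M : (forall t, is_derive t (1 : R) x (dx t)) ->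
  (forall t, `|dx t| <= M) -> forall s t, `|x s - x t| <= M * `|s - t|.
Proof.
move=> dX bd s t.
wlog st : s t / s <= t => [H|].
  by case: (leP s t) => [/H//|/ltW/H]; rewrite distrC (distrC t).
have [c _ E] := @MVT_segment R x dx s t st (fun z _ => dX z)
  (continuous_subspaceT (derivable_continuous (fun z => @ex_derive _ _ _ _ _ _ _ (dX z)))).
by rewrite distrC E normrM (distrC t) ler_wpM2r.
Qed.

Lemma derive1_periodic (V : normedModType R) (f : R -> V) : (forall t, f (t + 1) = f t) ->
  forall t, derive1 f (t + 1) = derive1 f t.
Proof.
move=> per t; rewrite /derive1.
suff -> : (fun h : R => h^-1 *: (f (h + (t + 1)) - f (t + 1))) =
          (fun h : R => h^-1 *: (f (h + t) - f t)) by [].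
by apply/funext => h; rewrite addrA !per.
Qed.

End Periodic.

(** If [d2] were negative, [dk], which vanishes at 0, would be negative just to the right of it, and
    the mean value theorem would give a value below [k 0]. *)
Lemma second_derivative_at_min (R : realType) (k dk : R -> R) (d2 : R) :
  (forall t, is_derive t (1 : R) k (dk t)) -> is_derive 0 (1 : R) dk d2 ->
  (forall t, k 0 <= k t) -> 0 <= d2.
Proof.
move=> dK dDk kmin.
have dk0 : dk 0 = 0.
  have := @derive1_at_min R k (-1) 1 0 _ (fun t _ => @ex_derive _ _ _ _ _ _ _ (dK t)) _ (fun t _ => kmin t).
  move=> H; rewrite -(@derive_val _ _ _ _ _ _ _ (dK 0)).
  by apply: derive_val; apply: H; rewrite ?in_itv /=; lra.
rewrite leNgt; apply/negP => d20.
have [e /= e0 He] : exists2 e : R, 0 < e & forall h : R, 0 < h < e -> dk h < 0.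
  have d2e : 0 < - d2 / 2 by lra.
  have /eqaddoP/(_ _ d2e) := derivable_nbhs (@ex_derive _ _ _ _ _ _ _ dDk).
  case/nbhs_normP => e /= e0 He; exists e => // h /andP[h0 he].
  have := He h; rewrite /ball_ /= sub0r normrN gtr0_norm // !fctE /= addr0 derive_val dk0.
  rewrite /GRing.scale /= mulr1 add0r => /(_ he); rewrite ler_norml => /andP[_].
  by nra.
have e20 : 0 < e / 2 by lra.
have [c] := @MVT R k dk 0 (e / 2) e20 (fun z _ => dK z)
  (continuous_subspaceT (derivable_continuous (fun z => @ex_derive _ _ _ _ _ _ _ (dK z)))).
rewrite in_itv /= => /andP[c0 ce] E.
have hc : dk c < 0 by apply: He; lra.
have := kmin (e / 2); nra.
Qed.

(** * The gradient of the inner product of two points of a curve *)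

(** Regular zeros are isolated, and the Lipschitz bounds keep zeros away from every other point;
    compactness concludes. *)
Lemma zeros_finite (R : realType) (P Q : R -> R -> R) L a b c d : 0 <= L ->
  lipschitz2 L P -> lipschitz2 L Q ->
  (forall s u, a <= s <= b -> c <= u <= d -> P s u = 0 -> Q s u = 0 ->
     exists D, regular_zero P Q (s, u) D) ->
  finite_set [set z : R * R | [/\ a <= z.1 <= b, c <= z.2 <= d, P z.1 z.2 = 0 & Q z.1 z.2 = 0]].
Proof.
move=> L0 LP LQ reg.
have cK : compact (`[a, b]%classic `*` `[c, d]%classic : set (R * R)).
  by apply: compact_setX; exact: segment_compact.
suff : finite_set ((`[a, b]%classic `*` `[c, d]%classic) `&`
    [set z : R * R | P z.1 z.2 = 0 /\ Q z.1 z.2 = 0]).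
  by apply: sub_finite_set => z [z1 z2 z3 z4]; split => //; split; rewrite /= in_itv.
apply: compact_isolated_finite cK _ => -[s u] [/=]; rewrite !in_itv /= => hs hu.
have [/andP[/eqP p0 /eqP q0]|pq] := boolP ((P s u == 0) && (Q s u == 0)).
  have [D /regular_zero_isolated[r r0 iso]] := reg _ _ hs hu p0 q0.
  exists (ball s r, ball u r) => /=; first by split; exact: nbhsx_ballx.
  move=> [s' u'] /= [b1 b2] [p0' q0']; apply: iso => //=; rewrite distrC; exact: ltW.
have ne f : lipschitz2 L f -> f s u != 0 -> \forall z \near (s, u), f z.1 z.2 <> 0.
  move=> Lf f0; pose e := `|f s u| / (4 * (L + 1)).
  have L1 : 0 < 4 * (L + 1) by lra.
  have f0' : 0 < `|f s u| by rewrite normr_gt0.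
  have e0 : 0 < e by rewrite divr_gt0.
  have eE : 4 * (L + 1) * e = `|f s u| by rewrite /e mulrC divfK // gt_eqF.
  exists (ball s e, ball u e) => /=; first by split; exact: nbhsx_ballx.
  move=> [s' u'] /= [b1 b2] f'0; have := Lf s u s' u'; rewrite f'0 subr0.
  rewrite /ball /= in b1 b2.
  have : L * (`|s - s'| + `|u - u'|) <= L * (2 * e) by rewrite ler_wpM2l //; lra.
  nra.
move: pq; rewrite negb_and => /orP[p0|q0].
  by have := ne P LP p0; apply: filterS => z /= + [].
by have := ne Q LQ q0; apply: filterS => z /= + [].
Qed.

(* If (p, q) is the Hessian with entries A, M, C applied to (x, x + y), up to a small
   error, then Cramer's rule recovers (x, y) from (p, q) up to a small error. *)
Lemma cramer_approx (R : realFieldType) (A M C p q x y k : R) :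
  let D := A * C - M ^+ 2 in
  D != 0 -> 0 <= k -> k * (64 * (`|A| + `|M| + `|C| + 1)) = `|D| ->
  `|p - (x * A + (x + y) * M)| <= k * (`|x| + `|x + y|) ->
  `|q - (x * M + (x + y) * C)| <= k * (`|x| + `|x + y|) ->
  exists X Y, [/\ p = (A + M) * X + M * Y, q = (M + C) * X + C * Y,
    `|X - x| <= (`|x| + `|y|) / 8 & `|Y - y| <= (`|x| + `|y|) / 8].
Proof.
move=> D D0 k0 kE hp hq.
set S := `|A| + `|M| + `|C| + 1 in kE.
have nA := normr_ge0 A; have nM := normr_ge0 M; have nC := normr_ge0 C.
have D1 : 0 < `|D| by rewrite normr_gt0.
have bnd : `|x| + `|x + y| <= 2 * (`|x| + `|y|) by have := ler_normD x y; have := normr_ge0 y; lra.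
have {}hp := le_trans hp (ler_wpM2l k0 bnd).
have {}hq := le_trans hq (ler_wpM2l k0 bnd).
set ep := p - _ in hp; set eq := q - _ in hq.
(* Two terms, each a coefficient up to [2 * S] times an error up to [2 * k * (|x| + |y|)]: the
   factor 64 in [kE] leaves exactly one eighth. *)
have err a b : `|a| <= 2 * S -> `|b| <= 2 * S -> `|(a * ep + b * eq) / D| <= (`|x| + `|y|) / 8.
  move=> ha hb; rewrite normf_div ler_pdivrMr // -kE.
  apply: le_trans (ler_normD _ _) _; rewrite !normrM.
  have : `|a| * `|ep| <= 2 * S * (k * (2 * (`|x| + `|y|))) by rewrite ler_pM.
  have : `|b| * `|eq| <= 2 * S * (k * (2 * (`|x| + `|y|))) by rewrite ler_pM.
  move: `|x| `|y| S (`|a| * _) (`|b| * _) {nA nM nC D1 bnd hp hq kE ha hb} => *; lra.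
exists ((C * p - M * q) / D), (((A + M) * q - (M + C) * p) / D).
split.
- by transitivity (D / D * p); [rewrite divff // mul1r|rewrite /D; ring].
- by transitivity (D / D * q); [rewrite divff // mul1r|rewrite /D; ring].
- rewrite (_ : _ - x = (C * ep + (- M) * eq) / D); last first.
    by rewrite -[x in LHS]mul1r -(divff D0) /ep /eq /D; ring.
  by apply: err; rewrite ?normrN /S; lra.
- rewrite (_ : _ - y = (- (M + C) * ep + (A + M) * eq) / D); last first.
    by rewrite -[y in LHS]mul1r -(divff D0) /ep /eq /D; ring.
  by apply: err; rewrite ?normrN /S; [have := ler_normD M C|have := ler_normD A M]; lra.
Qed.

Lemma is_derive_line (R : realType) (F : R * R -> R) (v p : R * R) (h0 : R) :
  derivable F (h0 *: v + p) v ->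
  is_derive h0 (1 : R) (fun h => F (h *: v + p)) ('D_v F (h0 *: v + p)).
Proof.
have E : (fun h : R => h^-1 *: (((fun h => F (h *: v + p)) \o shift h0) (h *: 1) - F (h0 *: v + p)))
   = (fun h : R => h^-1 *: ((F \o shift (h0 *: v + p)) (h *: v) - F (h0 *: v + p))).
  by apply/funext => h /=; rewrite [_ *: 1]mulr1 scalerDl addrA.
by move=> dF; split; rewrite /derivable /derive E.
Qed.

(** For a negative determinant, [(M, - A)] and [(C, - M)] would give [A <= 0] and [C <= 0], the
    basis vectors then [A = C = 0], and the vectors [(1, 1)] and [(1, -1)] finally [M = 0]. *)
Lemma quadratic_form_det_ge0 (R : realFieldType) (A M C : R) :
  (forall x y, 0 <= x * (x * A + y * M) + y * (x * M + y * C)) -> 0 <= A * C - M ^+ 2.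
Proof.
move=> H; rewrite leNgt; apply/negP => D0.
have h1 := H M (- A); have h2 := H C (- M); have h3 := H 1 0; have h4 := H 0 1.
have h5 := H 1 1; have h6 := H 1 (-1).
have A0 : A = 0.
  apply/eqP; rewrite eq_le; apply/andP; split; last lra.
  by rewrite leNgt; apply/negP => Ap; nra.
have C0 : C = 0.
  apply/eqP; rewrite eq_le; apply/andP; split; last lra.
  by rewrite leNgt; apply/negP => Ap; nra.
rewrite A0 C0 in h5 h6 D0; have M0 : M = 0 by lra.
by rewrite M0 mul0r expr2 mulr0 subrr ltxx in D0.
Qed.

Lemma int_between0_2 (R : numDomainType) (n : int) :
  0 < n%:~R :> R -> n%:~R < 2%:~R :> R -> n = 1.
Proof. by rewrite ltr0z ltr_int; lia. Qed.

Section Curve.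
Context {R : realType}.
Variables (g : R -> 'rV[R]_3) (sigma : R).
Local Notation form := (@spacelike_form R).
Local Notation g1 := (derive1 g).
Local Notation g2 := (derive1 (derive1 g)).
Hypothesis per : forall t, g (t + 1) = g t.
Hypothesis sm : smooth g.
Hypothesis gg : forall t, form (g t) (g t) = sigma.
Hypothesis pos : forall t, 0 < form (g1 t) (g1 t).

Let d0 t : derivable g t 1. Proof. by have := @sm 0%N t; rewrite derive1n0. Qed.
Let d1 t : derivable g1 t 1. Proof. by have := @sm 1%N t; rewrite derive1n1. Qed.
Let d2 t : derivable g2 t 1. Proof. by have := @sm 2%N t; rewrite derive1nS derive1n1. Qed.
Arguments d0 : clear implicits.
Arguments d1 : clear implicits.
Arguments d2 : clear implicits.
Let per1 : forall t, g1 (t + 1) = g1 t := derive1_periodic per.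
Let per2 : forall t, g2 (t + 1) = g2 t := derive1_periodic per1.

Lemma form_velocity t : form (g t) (g1 t) = 0.
Proof.
have H := is_derive_form (d0 t) (d0 t).
have := @derive_val _ _ _ _ _ _ _ H.
rewrite (_ : (fun s => _) = cst sigma); last by apply/funext => s; rewrite gg.
by rewrite derive_cst (formC (g1 t)) => /eqP; rewrite eq_sym -mulr2n mulrn_eq0 /= => /eqP.
Qed.

Lemma form_acceleration t : form (g t) (g2 t) = - form (g1 t) (g1 t).
Proof.
have H := is_derive_form (d0 t) (d1 t).
have := @derive_val _ _ _ _ _ _ _ H.
rewrite (_ : (fun s => _) = cst 0); last by apply/funext => s; rewrite form_velocity.
by rewrite derive_cst => /eqP; rewrite eq_sym addrC addr_eq0 => /eqP.
Qed.

Lemma entries_bounded (f : R -> 'rV[R]_3) : (forall t, derivable f t 1) ->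
  (forall t, f (t + 1) = f t) -> exists2 M, 0 <= M & forall t i, `|f t 0 i| <= M.
Proof.
move=> df pf.
have bd i : exists2 M, 0 <= M & forall t, `|f t 0 i| <= M.
  apply: (@periodic_bounded R (fun t => f t 0 i)) => [|t]; last by rewrite pf.
  by apply: derivable_continuous => t; move/derivable_mxP: (df t).
have [M0 M00 H0] := bd 0; have [M1 M10 H1] := bd 1; have [M2 M20 H2] := bd 2.
exists (M0 + M1 + M2) => [|t i]; first by rewrite !addr_ge0.
have := H0 t; have := H1 t; have := H2 t.
case: i => [[|[|[|//]]] hi].
- by rewrite (_ : Ordinal hi = 0); [lra|exact: val_inj].
- by rewrite (_ : Ordinal hi = 1); [lra|exact: val_inj].
- by rewrite (_ : Ordinal hi = 2); [lra|exact: val_inj].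
Qed.

Definition bounded_lipschitz M (f : R -> 'rV[R]_3) := (forall t i, `|f t 0 i| <= M) /\
  (forall s t i, `|f s 0 i - f t 0 i| <= M * `|s - t|).

Lemma curve_bounded_lipschitz : exists M, [/\ 0 <= M, bounded_lipschitz M g & bounded_lipschitz M g1].
Proof.
have [M0 M00 H0] := entries_bounded d0 per.
have [M1 M10 H1] := entries_bounded d1 per1.
have [M2 M20 H2] := entries_bounded d2 per2.
exists (M0 + M1 + M2); split; first by rewrite !addr_ge0.
  split=> [t i|s t i]; first by have := H0 t i; lra.
  apply: (@derivative_bound_lipschitz _ (fun t => g t 0 i) (fun t => g1 t 0 i)) => z.
    exact: is_derive_entry.
  by have := H1 z i; lra.
split=> [t i|s t i]; first by have := H1 t i; lra.
apply: (@derivative_bound_lipschitz _ (fun t => g1 t 0 i) (fun t => g2 t 0 i)) => z.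
  exact: is_derive_entry.
by have := H2 z i; lra.
Qed.

Lemma form_lipschitz M f h s t s' t' : 0 <= M -> bounded_lipschitz M f -> bounded_lipschitz M h ->
  `|form (f s) (h t) - form (f s') (h t')| <= 3 * M ^+ 2 * (`|s - s'| + `|t - t'|).
Proof.
move=> M0 [bf lf] [bh lh].
have e i : `|f s 0 i * h t 0 i - f s' 0 i * h t' 0 i| <= M ^+ 2 * (`|s - s'| + `|t - t'|).
  have -> : f s 0 i * h t 0 i - f s' 0 i * h t' 0 i =
    (f s 0 i - f s' 0 i) * h t 0 i + f s' 0 i * (h t 0 i - h t' 0 i) by ring.
  apply: le_trans (ler_normD _ _) _; rewrite [leRHS]mulrDr !normrM; apply: lerD.
    by apply: (le_trans (ler_pM _ _ (lf _ _ _) (bh _ _))) => //; rewrite expr2; lra.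
  by apply: (le_trans (ler_pM _ _ (bf _ _) (lh _ _ _))) => //; rewrite expr2; lra.
have -> : form (f s) (h t) - form (f s') (h t') =
   (f s 0 0 * h t 0 0 - f s' 0 0 * h t' 0 0) + (f s 0 1 * h t 0 1 - f s' 0 1 * h t' 0 1)
   - (f s 0 2 * h t 0 2 - f s' 0 2 * h t' 0 2) by rewrite /spacelike_form; ring.
apply: le_trans (ler_normB _ _) _.
have := ler_normD (f s 0 0 * h t 0 0 - f s' 0 0 * h t' 0 0)
  (f s 0 1 * h t 0 1 - f s' 0 1 * h t' 0 1).
have := e 0; have := e 1; have := e 2; lra.
Qed.

(* The gradient of (s, t) |-> form (g s) (g t) at the point (s, s + u). *)
Definition grad1 s u := form (g1 s) (g (s + u)).
Definition grad2 s u := form (g s) (g1 (s + u)).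

Lemma grad_lipschitz : exists L, [/\ 0 <= L, lipschitz2 L grad1 & lipschitz2 L grad2].
Proof.
have [M [M0 b0 b1]] := curve_bounded_lipschitz.
exists (6 * M ^+ 2); split; first by rewrite mulr_ge0 ?sqr_ge0.
  move=> s u s' u'; apply: (le_trans (form_lipschitz _ _ _ _ M0 b1 b0)).
  rewrite (_ : s + u - (s' + u') = (s - s') + (u - u')); last by ring.
  by have := ler_normD (s - s') (u - u'); have := sqr_ge0 M; have := normr_ge0 (u - u'); nra.
move=> s u s' u'; apply: (le_trans (form_lipschitz _ _ _ _ M0 b0 b1)).
rewrite (_ : s + u - (s' + u') = (s - s') + (u - u')); last by ring.
by have := ler_normD (s - s') (u - u'); have := sqr_ge0 M; have := normr_ge0 (u - u'); nra.
Qed.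

(** For fixed [t], [form (g a) (g1 t)] vanishes at [a = t] and increases in [a] nearby, its
    derivative being close to [form (g1 t) (g1 t) > 0]. Hence [(grad1, grad2)] points out of the
    strip [e <= u <= 1 - e]. *)
Lemma grad2_near_diagonal : exists e, [/\ 0 < e, e < 1 / 2 &
  forall s u, 0 < u <= e -> grad2 s u < 0 /\ 0 < grad2 s (- u)].
Proof.
have [M [M0 b0 b1]] := curve_bounded_lipschitz.
have [E E0 HE] : exists2 E, 0 < E & forall t, E <= form (g1 t) (g1 t).
  have [||s Hs] := @periodic_max R (fun t => - form (g1 t) (g1 t)).
  - by apply: derivable_continuous => t; apply: derivableN; apply: ex_derive; exact: is_derive_form.
  - by move=> t; rewrite !per1.
  by exists (form (g1 s) (g1 s)) => [|t]; [exact: pos|have := Hs t; rewrite lerN2].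
pose K := 3 * M ^+ 2 + 1.
have K0 : 0 < 2 * K by rewrite /K; have := sqr_ge0 M; lra.
(* [K] dominates the Lipschitz constant, so the form loses at most [E / 2] within distance [e]. *)
pose e := Num.min (1 / 4) (E / (2 * K)).
have e0 : 0 < e by rewrite lt_min divr_gt0 //= divr_gt0.
have eK : e * (2 * K) <= E by rewrite -ler_pdivlMr // /e ge_min lexx orbT.
have near x t : `|x - t| <= e -> 0 < form (g1 x) (g1 t).
  move=> xt; have := form_lipschitz x t t t M0 b1 b1.
  rewrite (subrr t) normr0 addr0 => H.
  have := HE t; have : 3 * M ^+ 2 * `|x - t| <= K * e.
    by rewrite ler_pM ?normr_ge0 ?mulr_ge0 ?sqr_ge0 // /K lerDl.
  move: H; rewrite ler_norml => /andP[+ _].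
  move: (form (g1 x) (g1 t)) (form (g1 t) (g1 t)) => a b; move: eK E0.
  by clearbody K e; clear; move: (_ * `|_|) => c *; nra.
have mvt a b t : a < b -> exists2 c, a < c < b &
    form (g b) (g1 t) - form (g a) (g1 t) = form (g1 c) (g1 t) * (b - a).
  move=> ab; have dF z : is_derive z (1 : R) (fun s => form (g s) (g1 t)) (form (g1 z) (g1 t)).
    have := is_derive_form (d0 z) (derivable_cst (g1 t) z 1).
    move=> H; apply: (is_derive_eq H).
    by rewrite derive1_cst form0r addr0.
  have [c] := @MVT R _ _ a b ab (fun z _ => dF z)
    (continuous_subspaceT (derivable_continuous (fun z => @ex_derive _ _ _ _ _ _ _ (dF z)))).
  by rewrite in_itv /= => cab E'; exists c.
have e4 : e <= 1 / 4 by rewrite /e ge_min lexx.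
exists e; split => //; first lra.
move=> s u /andP[u0 ue]; rewrite /grad2; split.
  have [|c /andP[c1 c2]] := mvt s (s + u) (s + u); first lra.
  rewrite form_velocity sub0r => H.
  have : 0 < form (g1 c) (g1 (s + u)) by apply: near; rewrite ler_norml; lra.
  by nra.
have [|c /andP[c1 c2]] := mvt (s - u) s (s - u); first lra.
rewrite form_velocity subr0 => ->.
rewrite mulr_gt0 //; last by lra.
by apply: near; rewrite ler_norml; lra.
Qed.

Definition hess_det s t := form (g2 s) (g t) * form (g s) (g2 t) - form (g1 s) (g1 t) ^+ 2.

(** In the coordinates [(s, u)] the Jacobian of [(grad1, grad2)] has rows [(A + M, M)] and
    [(M + C, C)], so its determinant is still [A * C - M ^+ 2]. *)
Lemma grad_regular_zero s u : grad1 s u = 0 -> grad2 s u = 0 -> hess_det s (s + u) != 0 ->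
  regular_zero grad1 grad2 (s, u) (hess_det s (s + u)).
Proof.
move=> p0 q0; rewrite /hess_det.
set A := form (g2 s) _; set C := form (g s) (g2 _); set M := form (g1 s) (g1 _).
move=> D0; exists (A + M), M, (M + C), C; split; [ring|done|].
pose S := `|A| + `|M| + `|C| + 1.
have S0 : 0 < 64 * S by rewrite mulr_gt0 // ltr_wpDl // !addr_ge0.
pose k := `|A * C - M ^+ 2| / (64 * S).
have k0 : 0 < k by rewrite divr_gt0 // normr_gt0.
have kE : k * (64 * S) = `|A * C - M ^+ 2| by rewrite /k divfK // gt_eqF.
have [r1 r10 H1] := form_first_order (p := (s, s + u)) (d1 s) (d0 (s + u)) k0.
have [r2 r20 H2] := form_first_order (p := (s, s + u)) (d0 s) (d1 (s + u)) k0.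
pose r := Num.min r1 r2; have r0 : 0 < r by rewrite lt_min r10.
(* Halved because [s' + u'] moves by up to the sum of both displacements. *)
exists (r / 2) => [|s' u' /= hs hu]; first by rewrite divr_gt0.
have rr1 : r <= r1 by rewrite /r ge_min lexx.
have rr2 : r <= r2 by rewrite /r ge_min lexx orbT.
have tE : s' + u' - (s + u) = (s' - s) + (u' - u) by ring.
have ht : `|s' + u' - (s + u)| <= r.
  by rewrite tE; apply: le_trans (ler_normD _ _) _; rewrite [leRHS]splitr lerD.
have hs1 : `|s' - s| <= r by apply: le_trans hs _; rewrite [leRHS]splitr lerDl ltW // divr_gt0.
have /= := H2 s' (s' + u') (le_trans hs1 rr2) (le_trans ht rr2).
have /= := H1 s' (s' + u') (le_trans hs1 rr1) (le_trans ht rr1).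
rewrite -[form (g1 s) (g (s + u))]/(grad1 s u) p0 -[form (g s) (g1 (s + u))]/(grad2 s u) q0 !subr0 tE.
by apply: cramer_approx => //; exact: ltW.
Qed.

#[local] Opaque derive1 spacelike_form.

(** One representative for each unordered pair of distinct circle points; coincidences are
    included. *)
Definition critical_pairs : set (R * R) := [set p | [/\ 0 <= p.1, p.1 < p.2, p.2 < 1,
  form (g1 p.1) (g p.2) = 0 & form (g p.1) (g1 p.2) = 0]].

Lemma hess_detC s t : hess_det s t = hess_det t s.
Proof.
have H (u2 u1 u v2 v1 v : 'rV[R]_3) : form u2 v * form u v2 - form u1 v1 ^+ 2 =
    form v2 u * form v u2 - form v1 u1 ^+ 2.
  by rewrite mulrC (formC u v2) (formC u2 v) (formC u1 v1).
exact: H.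
Qed.

Lemma hess_det_int s t (m n : int) : hess_det (s + m%:~R) (t + n%:~R) = hess_det s t.
Proof. by rewrite /hess_det !(periodic_intr per, periodic_intr per1, periodic_intr per2). Qed.

Lemma hess_det_shift s t : hess_det s (t + 1) = hess_det s t.
Proof. by rewrite /hess_det per per1 per2. Qed.

Lemma grad1_int s u (n : int) : grad1 (s + n%:~R) u = grad1 s u.
Proof. by rewrite /grad1 addrAC (periodic_intr per) (periodic_intr per1). Qed.

Lemma grad2_int s u (n : int) : grad2 (s + n%:~R) u = grad2 s u.
Proof. by rewrite /grad2 addrAC (periodic_intr per) (periodic_intr per1). Qed.

Lemma grad1_shift s u : grad1 (s + 1) u = grad1 s u.
Proof. exact: (grad1_int s u 1). Qed.

Lemma grad2_shift s u : grad2 (s + 1) u = grad2 s u.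
Proof. exact: (grad2_int s u 1). Qed.

Lemma grad2_shift_gap s u : grad2 s (u + 1) = grad2 s u.
Proof. by rewrite /grad2 addrA per1. Qed.

(** Up to a period in [s], an unordered pair occurs twice in the strip, once for each point from
    which the gap [u] can be measured. *)
Lemma strip_zero s u : 0 < u < 1 -> grad1 s u = 0 -> grad2 s u = 0 ->
  exists p, [/\ critical_pairs p, hess_det s (s + u) = hess_det p.1 p.2 &
    exists n : int, (s, u) = (p.1 + n%:~R, p.2 - p.1) \/
                    (s, u) = (p.2 + n%:~R, p.1 + 1 - p.2)].
Proof.
move=> /andP[u0 u1]; have [s' /andP[s0 s1] [n ->]] := circle_rep s.
rewrite grad1_int grad2_int => z1 z2.
have [lt|le] := ltP (s' + u) 1.
  exists (s', s' + u); split; rewrite /critical_pairs /=.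
  - by rewrite s0 lt ltrDl u0; split.
  - by rewrite addrAC hess_det_int.
  - by exists n; left; congr pair; ring.
(* The second point wraps around and becomes the smaller representative, so the two arguments change
   roles. *)
have E : s' + u = (s' + u - 1) + 1 by ring.
exists (s' + u - 1, s'); split; rewrite /critical_pairs /=.
- rewrite /grad1 E per in z1; rewrite /grad2 E per1 in z2.
  split; [by rewrite subr_ge0|by rewrite ltrBlDr ltrD2l|exact: s1|rewrite formC; exact: z2|rewrite formC; exact: z1].
- by rewrite addrAC hess_det_int [in LHS]E hess_det_shift hess_detC.
- by exists n; right; congr pair; ring.
Qed.

Lemma critical_strip p : critical_pairs p ->
  [/\ grad1 p.1 (p.2 - p.1) = 0, grad2 p.1 (p.2 - p.1) = 0,
      grad1 p.2 (p.1 + 1 - p.2) = 0 & grad2 p.2 (p.1 + 1 - p.2) = 0].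
Proof.
move=> [p0 p12 p1 z1 z2].
have E1 : p.1 + (p.2 - p.1) = p.2 by ring.
have E2 : p.2 + (p.1 + 1 - p.2) = p.1 + 1 by ring.
by rewrite /grad1 /grad2 E1 E2 per per1 z1 z2 !(formC _ (g p.1)) !(formC _ (g1 p.1)) z1 z2.
Qed.

#[local] Opaque grad1 hess_det.

Hypothesis reg : forall p, critical_pairs p -> hess_det p.1 p.2 != 0.

(** The index sum over one period of the strip is twice the sum over pairs, because both zeros of a
    pair have the same Hessian determinant. *)
Lemma critical_pairs_index : exists T : seq (R * R),
  [/\ uniq T, forall p, critical_pairs p <-> p \in T &
      \sum_(p <- T) sgz (hess_det p.1 p.2) = 0].
Proof.
have [e [e0 e12 He]] := grad2_near_diagonal.
have [L [L0 L1 L2]] := grad_lipschitz.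
have in_strip s u : 0 < u < 1 -> grad2 s u = 0 -> e < u < 1 - e.
  move=> /andP[u0 u1] z; rewrite !ltNge -negb_or; apply/negP => /orP[ue|ue].
    by have [|+ _] := He s u; [rewrite u0|rewrite z ltxx].
  have [|_] := He s (1 - u); first by lra.
  by rewrite -grad2_shift_gap opprB subrK z ltxx.
have regz s u : 0 < u < 1 -> grad1 s u = 0 -> grad2 s u = 0 ->
    regular_zero (grad1) (grad2) (s, u) (hess_det s (s + u)).
  move=> hu z1 z2; apply: grad_regular_zero => //.
  by have [p [/reg cp -> _]] := strip_zero hu z1 z2.
have finC : finite_set critical_pairs.
  have /(finite_image (fun z : R * R => (z.1, z.1 + z.2))) F :
      finite_set [set z | [/\ 0 <= z.1 <= 1, e <= z.2 <= 1 - e, grad1 z.1 z.2 = 0 & grad2 z.1 z.2 = 0]].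
    apply: (zeros_finite L0 L1 L2) => s u _ /andP[u0 u1] z1 z2.
    by exists (hess_det s (s + u)); apply: regz => //; lra.
  apply: sub_finite_set F => p cp; exists (p.1, p.2 - p.1).
    have [z1 z2 _ _] := critical_strip cp; case: cp => p0 p12 p1 _ _.
    have /andP[u1 u2] : e < p.2 - p.1 < 1 - e by apply: in_strip z2; lra.
    by split => //=; lra.
  by rewrite /= addrC subrK; case: (p).
have [T0 ET] := (finite_seqP _).1 finC.
pose T := undup T0.
have HT p : critical_pairs p <-> p \in T by rewrite mem_undup ET.
exists T; split => //; first exact: undup_uniq.
(* All critical coordinates lie in [[0, a[], so a period starting at [a] has no zero on its vertical
   sides. *)
have [a [a0 a1 Ha]] : exists a : R, [/\ 0 < a, a < 1 & forall p, p \in T -> p.2 < a].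
  have : forall p, p \in T -> p.2 < 1 by move=> p /HT[].
  elim: T {HT} => [_|p T IH H]; first by exists (1 / 2); split => //; lra.
  have [|a [a0 a1 Ha]] := IH; first by move=> q qT; apply: H; rewrite inE qT orbT.
  have p1 := H p (mem_head _ _).
  exists (Num.max a ((1 + p.2) / 2)); split; first by rewrite lt_max a0.
    by rewrite gt_max a1 /=; lra.
  move=> q; rewrite inE lt_max => /predU1P[->|/Ha->//].
  by apply/orP; right; lra.
(* The two zeros of a pair, moved by 1 to lie in [a < s < a + 1]. *)
pose f1 (p : R * R) := (p.1 + 1, p.2 - p.1).
pose f2 (p : R * R) := (p.2 + 1, p.1 + 1 - p.2).
pose Z := [seq f1 p | p <- T] ++ [seq f2 p | p <- T].
pose h z := sgz (hess_det z.1 (z.1 + z.2)).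
have S1 : \sum_(z <- [seq f1 p | p <- T]) h z = \sum_(p <- T) sgz (hess_det p.1 p.2).
  rewrite big_map; apply: eq_bigr => p _; rewrite /h; congr sgz; rewrite /f1 /=.
  rewrite (_ : p.1 + 1 + (p.2 - p.1) = p.2 + 1); last by ring.
  by rewrite hess_det_shift hess_detC hess_det_shift hess_detC.
have S2 : \sum_(z <- [seq f2 p | p <- T]) h z = \sum_(p <- T) sgz (hess_det p.1 p.2).
  rewrite big_map; apply: eq_bigr => p _; rewrite /h; congr sgz; rewrite /f2 /=.
  rewrite (_ : p.2 + 1 + (p.1 + 1 - p.2) = p.1 + 1 + 1); last by ring.
  by rewrite !hess_det_shift hess_detC hess_det_shift.
suff : \sum_(z <- Z) h z = 0.
  by rewrite /Z big_cat S1 S2 /= -mulr2n => /eqP; rewrite mulrn_eq0 /= => /eqP.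
have e_e : e < 1 - e by lra.
apply: (@index_sum_annulus R (grad1) (grad2) L a e (1 - e) Z (fun z => hess_det z.1 (z.1 + z.2)) L0 L1 L2 e_e).
- by move=> u; exact: grad1_shift.
- by move=> u; exact: grad2_shift.
- by move=> s; have [|//] := He s e; rewrite e0 lexx.
- move=> s; have [|_] := He s e; first by rewrite e0 lexx.
  by rewrite addrC grad2_shift_gap.
- rewrite /Z cat_uniq; apply/and3P; split.
  + rewrite map_inj_in_uniq; first exact: undup_uniq.
    by move=> [p1 p2] [q1 q2] _ _ [/addIr -> /addIr ->].
  + apply/hasPn => _ /mapP[p /HT[p0 p12 p1 _ _] ->]; apply/negP.
    by move=> /mapP[q /HT[q0 q12 q1 _ _] [E1 E2]]; lra.
  + rewrite map_inj_in_uniq; first exact: undup_uniq.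
    by move=> [p1 p2] [q1 q2] _ _ [/addIr -> /addIr /addIr ->].
- move=> z; rewrite mem_cat => /orP[]/mapP[p pT ->]; have cp := (HT p).2 pT;
    have [z1 z2 z3 z4] := critical_strip cp; case: cp => p0 p12 p1 _ _; have pa := Ha p pT; rewrite /f1 /f2 /=.
  + have hu : 0 < p.2 - p.1 < 1 by lra.
    split; [|by lra|exact: in_strip z2].
    by apply: (regz _ _ hu); rewrite ?grad1_shift ?grad2_shift.
  + have hu : 0 < p.1 + 1 - p.2 < 1 by lra.
    split; [|by lra|exact: in_strip z4].
    by apply: (regz _ _ hu); rewrite ?grad1_shift ?grad2_shift.
move=> s u /andP[s0 s1] /andP[u0 u1] z1 z2.
have hu : 0 < u < 1 by lra.
have [p [/HT pT _ [n]]] := strip_zero hu z1 z2.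
have [p0 p12 p1 _ _] := (HT p).2 pT; have pa := Ha p pT.
(* As [s] lies in [[a, a + 1]] and [a < 1], the shift lies strictly between 0 and 2. *)
have n1 q : 0 <= q < a -> s = q + n%:~R -> n = 1.
  move=> /andP[q0 qa] sE.
  have h1 : (0 : R) < n%:~R by lra.
  by apply: (int_between0_2 h1); rewrite /=; lra.
rewrite mem_cat => -[][sE uE].
  have /n1/(_ sE) n1' : 0 <= p.1 < a by lra.
  apply/orP; left; apply/mapP; exists p; [exact: pT|rewrite sE uE n1'; exact: erefl].
have /n1/(_ sE) n1' : 0 <= p.2 < a by lra.
apply/orP; right; apply/mapP; exists p; [exact: pT|rewrite sE uE n1'; exact: erefl].
Qed.


Lemma is_derive_form2 (f h : R -> 'rV[R]_3) (p v : R * R) :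
  derivable f p.1 1 -> derivable h p.2 1 ->
  is_derive p v (fun q : R * R => form (f q.1) (h q.2))
    (v.1 * form (derive1 f p.1) (h p.2) + v.2 * form (f p.1) (derive1 h p.2)).
Proof.
move=> df dh; have H := is_diff_form df dh.
by apply: DeriveDef; [exact: diff_derivable|exact: derive_form].
Qed.

(** Restriction to each line through [p] has a minimum at parameter 0, so the gradient vanishes and
    the Hessian is positive semidefinite. *)
Lemma form_minimum_hess (p : R * R) :
  (forall q : R * R, form (g p.1) (g p.2) <= form (g q.1) (g q.2)) ->
  [/\ form (g1 p.1) (g p.2) = 0, form (g p.1) (g1 p.2) = 0 & 0 <= hess_det p.1 p.2].
Proof.
move=> pmin.
pose F (q : R * R) := form (g q.1) (g q.2).
pose F1 (q : R * R) := form (g1 q.1) (g q.2).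
pose F2 (q : R * R) := form (g q.1) (g1 q.2).
have dF q v : is_derive q v F (v.1 * F1 q + v.2 * F2 q) := is_derive_form2 v (d0 q.1) (d0 q.2).
have dF1 q v : is_derive q v F1 (v.1 * form (g2 q.1) (g q.2) + v.2 * form (g1 q.1) (g1 q.2)) :=
  is_derive_form2 v (d1 q.1) (d0 q.2).
have dF2 q v : is_derive q v F2 (v.1 * form (g1 q.1) (g1 q.2) + v.2 * form (g q.1) (g2 q.2)) :=
  is_derive_form2 v (d0 q.1) (d1 q.2).
pose k v (h : R) := F (h *: v + p).
pose dk v (h : R) := v.1 * F1 (h *: v + p) + v.2 * F2 (h *: v + p).
have dK v h : is_derive h (1 : R) (k v) (dk v h).
  have /is_derive_line H := @ex_derive _ _ _ _ _ _ _ (dF (h *: v + p) v).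
  by apply: (is_derive_eq H); rewrite (@derive_val _ _ _ _ _ _ _ (dF (h *: v + p) v)).
have k0 v : 0 *: v + p = p by rewrite scale0r add0r.
have kmin v h : k v 0 <= k v h by rewrite /k k0; exact: pmin.
have dk0 v : dk v 0 = 0.
  have := @derive1_at_min R (k v) (-1) 1 0 _ (fun t _ => @ex_derive _ _ _ _ _ _ _ (dK v t)) _ (fun t _ => kmin v t).
  move=> H; rewrite -(@derive_val _ _ _ _ _ _ _ (dK v 0)).
  by apply: derive_val; apply: H; rewrite ?in_itv /=; lra.
have z1 : F1 p = 0 by have := dk0 (1, 0); rewrite /dk k0 /= mul1r mul0r addr0.
have z2 : F2 p = 0 by have := dk0 (0, 1); rewrite /dk k0 /= mul1r mul0r add0r.
split; [exact: z1|exact: z2|].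
apply: quadratic_form_det_ge0 => x y.
set v := (x, y).
have d1' := @ex_derive _ _ _ _ _ _ _ (dF1 (0 *: v + p) v).
have d2' := @ex_derive _ _ _ _ _ _ _ (dF2 (0 *: v + p) v).
have H1 := is_derive_line d1'; have H2 := is_derive_line d2'.
have H := is_deriveD (is_deriveZ x H1) (is_deriveZ y H2).
have {}H : is_derive 0 (1 : R) (dk v) (x * 'D_v F1 (0 *: v + p) + y * 'D_v F2 (0 *: v + p)) := H.
have := second_derivative_at_min (dK v) H (kmin v).
by rewrite k0 (@derive_val _ _ _ _ _ _ _ (dF1 p v)) (@derive_val _ _ _ _ _ _ _ (dF2 p v)).
Qed.

(** The global minimum on the torus. It is off the diagonal, since moving from [(0, 0)] to [(0, e)]
    already decreases the value below [sigma]; [reg] makes the determinant strictly positive. *)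
Lemma critical_minimum : exists p, [/\ critical_pairs p, 0 < hess_det p.1 p.2 &
  form (g p.1) (g p.2) < sigma].
Proof.
pose F (q : R * R) := form (g q.1) (g q.2).
have cF : continuous F.
  by move=> q; apply: differentiable_continuous; have H := is_diff_form (d0 q.1) (d0 q.2).
have cK : compact (`[0, 1]%classic `*` `[0, 1]%classic : set (R * R)).
  by apply: compact_setX; exact: segment_compact.
have [||p0 _ Hp0] := @compact_EVT_min _ R F _ _ cK _.
- by exists (0, 0); split; rewrite /= in_itv /= lexx ler01.
- exact: continuous_subspaceT.
have [s0 hs0 [m Es0]] := circle_rep p0.1; have [t0 ht0 [n Et0]] := circle_rep p0.2.
have F0 : F p0 = F (s0, t0).
  by rewrite /F Es0 Et0 !(periodic_intr per).
have Fmin q : F (s0, t0) <= F q.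
  have [s1 /andP[a1 a2] [m1 Es1]] := circle_rep q.1; have [t1 /andP[b1 b2] [n1 Et1]] := circle_rep q.2.
  rewrite -F0 [leRHS]/F Es1 Et1 !(periodic_intr per) -/(F (s1, t1)).
  by apply: Hp0; apply/mem_set; split; rewrite /= in_itv /= ?a1 ?b1 /= ltW.
have [e [e0 e12 He]] := grad2_near_diagonal.
have Fe : F (s0, t0) < sigma.
  apply: (le_lt_trans (Fmin (0, e))); rewrite /F /=.
  have dG z : is_derive z (1 : R) (fun t => form (g 0) (g t)) (form (g 0) (g1 z)).
    have H := is_derive_form (derivable_cst (g 0) z 1) (d0 z).
    by apply: (is_derive_eq H); rewrite derive1_cst formC form0r add0r.
  have [c] := @MVT R _ _ 0 e e0 (fun z _ => dG z)
    (continuous_subspaceT (derivable_continuous (fun z => @ex_derive _ _ _ _ _ _ _ (dG z)))).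
  rewrite in_itv /= gg subr0 => /andP[c0 ce] E.
  have [|h _] := He 0 c; first by rewrite c0 ltW.
  rewrite /grad2 add0r in h.
  by rewrite -subr_lt0 E pmulr_llt0.
have st : s0 != t0 by apply/eqP => st; move: Fe; rewrite /F st /= gg ltxx.
move: hs0 ht0 => /andP[s00 s01] /andP[t00 t01].
have [z1 z2 D0] := form_minimum_hess (p := (s0, t0)) Fmin.
have main p : p = (s0, t0) \/ p = (t0, s0) -> p.1 < p.2 -> critical_pairs p.
  case=> -> lt; split; [exact: s00|exact: lt|exact: t01|exact: z1|exact: z2|
      exact: t00|exact: lt|exact: s01|rewrite formC; exact: z2|rewrite formC; exact: z1].
have pos_det p : critical_pairs p -> 0 <= hess_det p.1 p.2 -> 0 < hess_det p.1 p.2.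
  by move=> /reg h1 h2; rewrite lt_neqAle eq_sym h1.
move: st; rewrite neq_lt => /orP[lt|lt].
  have cp := main (s0, t0) (or_introl erefl) lt.
  by exists (s0, t0); split; [exact: cp|exact: pos_det|exact: Fe].
have cp := main (t0, s0) (or_intror erefl) lt.
exists (t0, s0); split; [exact: cp|apply: pos_det; [exact: cp|rewrite hess_detC; exact: D0]|].
by rewrite formC; exact: Fe.
Qed.

End Curve.

(** * Lorentz geometry of the critical points *)

Section LorentzAlgebra.
Context {R : realType}.
Local Notation form := (@spacelike_form R).
Implicit Types u v w p X Y : 'rV[R]_3.

Lemma row3P u v : u 0 0 = v 0 0 -> u 0 1 = v 0 1 -> u 0 2 = v 0 2 -> u = v.
Proof.
move=> h0 h1 h2; apply/rowP => -[[|[|[|//]]] hi].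
- by rewrite (_ : Ordinal hi = 0) //; exact: val_inj.
- by rewrite (_ : Ordinal hi = 1) //; exact: val_inj.
- by rewrite (_ : Ordinal hi = 2) //; exact: val_inj.
Qed.

Definition cross u v : 'rV[R]_3 := \row_i
  [:: u 0 1 * v 0 2 - u 0 2 * v 0 1; u 0 2 * v 0 0 - u 0 0 * v 0 2;
      u 0 0 * v 0 1 - u 0 1 * v 0 0]`_i.

Lemma cross0_proportional u v : cross u v = 0 -> v != 0 -> exists k, u = k *: v.
Proof.
move=> /rowP c0 v0.
have := c0 0; have := c0 1; have := c0 2; rewrite !mxE /= => e2 e1 e0.
have [h0|n0] := eqVneq (v 0 0) 0; last first.
  by exists (u 0 0 / v 0 0); apply: row3P; rewrite !mxE; apply: (mulIf n0); rewrite ?divfK // mulrAC divfK //; lra.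
have [h1|n1] := eqVneq (v 0 1) 0; last first.
  by exists (u 0 1 / v 0 1); apply: row3P; rewrite !mxE; apply: (mulIf n1); rewrite ?divfK // mulrAC divfK //; lra.
have [h2|n2] := eqVneq (v 0 2) 0; last first.
  by exists (u 0 2 / v 0 2); apply: row3P; rewrite !mxE; apply: (mulIf n2); rewrite ?divfK // mulrAC divfK //; lra.
by move/eqP: v0; case; apply: row3P; rewrite !mxE.
Qed.

Lemma free_cross u v : free [:: u; v] -> cross u v != 0.
Proof.
rewrite free_cons span_seq1 seq1_free => /andP[uv v0]; apply/eqP => /cross0_proportional.
by move=> /(_ v0) [k E]; move/negP: uv; apply; apply/vlineP; exists k.
Qed.

(** The Lorentz Gram determinant of [X], [Y], [p] is minus the square of their Euclidean
    determinant; orthogonality to [p] makes the Gram matrix block diagonal. *)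
Lemma gram_det p X Y : form X p = 0 -> form Y p = 0 ->
  (form X X * form Y Y - form X Y ^+ 2) * form p p =
  - (cross X Y 0 0 * p 0 0 + cross X Y 0 1 * p 0 1 + cross X Y 0 2 * p 0 2) ^+ 2.
Proof.
move=> hX hY.
(* The added terms vanish and complete the three by three Gram determinant. *)
transitivity ((form X X * form Y Y - form X Y ^+ 2) * form p p
   - form X X * form Y p ^+ 2 - form Y Y * form X p ^+ 2 + 2 * form X Y * form X p * form Y p).
  by rewrite hX hY; ring.
by rewrite /spacelike_form !mxE /=; ring.
Qed.

Lemma tangent_gram_neq0 p X Y : form p p != 0 -> form X p = 0 -> form Y p = 0 ->
  free [:: X; Y] -> (form X X * form Y Y - form X Y ^+ 2) * form p p < 0.
Proof.
move=> p0 hX hY /free_cross c0; rewrite gram_det // oppr_lt0 lt_neqAle sqr_ge0 andbT eq_sym sqrf_eq0.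
apply: contra c0 => /eqP; set d := _ + _ => d0; apply/eqP.
(* Up to terms vanishing by orthogonality, [form p p] times [cross X Y] is [d] times [p] with its
   last coordinate negated; so [d = 0] would force [cross X Y = 0]. *)
have E0 : cross X Y 0 0 * form p p = d * p 0 0
    + p 0 1 * (Y 0 2 * form X p - X 0 2 * form Y p) - p 0 2 * (Y 0 1 * form X p - X 0 1 * form Y p).
  by rewrite /d /spacelike_form !mxE /=; ring.
have E1 : cross X Y 0 1 * form p p = d * p 0 1
    + p 0 2 * (Y 0 0 * form X p - X 0 0 * form Y p) - p 0 0 * (Y 0 2 * form X p - X 0 2 * form Y p).
  by rewrite /d /spacelike_form !mxE /=; ring.
have E2 : cross X Y 0 2 * form p p = - d * p 0 2
    + p 0 0 * (Y 0 1 * form X p - X 0 1 * form Y p) - p 0 1 * (Y 0 0 * form X p - X 0 0 * form Y p).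
  by rewrite /d /spacelike_form !mxE /=; ring.
rewrite hX hY d0 in E0 E1 E2.
by apply: row3P; apply: (mulIf p0); rewrite ?E0 ?E1 ?E2 mxE; ring.
Qed.

(** The common orthogonal complement of two independent vectors is a line. *)
Lemma orthogonal_parallel p r X Y : cross p r != 0 -> X != 0 -> Y != 0 ->
  form X p = 0 -> form X r = 0 -> form Y p = 0 -> form Y r = 0 ->
  exists2 c, c != 0 & Y = c *: X.
Proof.
move=> c0 X0 Y0 Xp Xr Yp Yr.
(* The Lorentzian cross product of [p] and [r], which spans this line. *)
pose w : 'rV[R]_3 := \row_i [:: cross p r 0 0; cross p r 0 1; - cross p r 0 2]`_i.
have w0 : w != 0.
  apply: contra c0 => /eqP/rowP w0; apply/eqP.
  have := w0 0; have := w0 1; have := w0 2; rewrite !mxE /= => e2 e1 e0.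
  by apply: row3P; rewrite !mxE /=; lra.
have par Z : form Z p = 0 -> form Z r = 0 -> exists k, Z = k *: w.
  move=> Zp Zr; apply: cross0_proportional w0.
  have E : cross Z w = \row_i [:: p 0 0 * - form Z r + r 0 0 * form Z p;
     p 0 1 * - form Z r + r 0 1 * form Z p; - p 0 2 * - form Z r - r 0 2 * form Z p]`_i.
    by apply: row3P; rewrite /spacelike_form !mxE /=; ring.
  by rewrite E Zp Zr; apply: row3P; rewrite !mxE /=; ring.
have [a Xa] := par X Xp Xr; have [b Yb] := par Y Yp Yr.
have a0 : a != 0 by apply: contra X0 => /eqP a0; rewrite Xa a0 scale0r.
have b0 : b != 0 by apply: contra Y0 => /eqP b0; rewrite Yb b0 scale0r.
by exists (b / a); [rewrite mulf_neq0 ?invr_eq0|rewrite Yb Xa scalerA divfK].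
Qed.

(** Proportional vectors with equal nonzero squares have a ratio [k] with [k ^+ 2 = 1]. *)
Lemma cross_neq0 s p r : s != 0 -> form p p = s -> form r r = s ->
  p <> r -> p <> - r -> cross p r != 0.
Proof.
move=> s0 pp rr pr pNr; apply/eqP => c0.
have r0 : r != 0 by apply: contra s0 => /eqP r0; rewrite -rr r0 form0r.
have [k Ek] := cross0_proportional c0 r0.
have E : k * (k * s) = s by rewrite -[RHS]pp Ek formZl formZr rr.
have : (k ^+ 2 - 1) * s = 0 by rewrite mulrBl mul1r expr2 -mulrA E subrr.
move/eqP; rewrite mulf_eq0 (negbTE s0) orbF subr_eq0 sqrf_eq1 => /orP[]/eqP k1.
  by apply: pr; rewrite Ek k1 scale1r.
by apply: pNr; rewrite Ek k1 scaleN1r.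
Qed.

Lemma timelike_orthogonal_pos p X : form p p = -1 -> X != 0 -> form X p = 0 -> 0 < form X X.
Proof.
move=> pp X0 Xp.
set x := p 0 0; set y := p 0 1; set z := p 0 2; set a := X 0 0; set b := X 0 1; set c := X 0 2.
have z2 : z ^+ 2 = 1 + x ^+ 2 + y ^+ 2 by move: pp; rewrite /spacelike_form -/x -/y -/z => pp; nra.
have cz : z * c = x * a + y * b by move: Xp; rewrite /spacelike_form -/x -/y -/z -/a -/b -/c; lra.
(* The factor [z ^+ 2] lets [z * c] be replaced by [x * a + y * b], which leaves a sum of
   squares. *)
have E : z ^+ 2 * form X X = a ^+ 2 + b ^+ 2 + (x * b - y * a) ^+ 2.
  rewrite /spacelike_form -/a -/b -/c.
  transitivity (z ^+ 2 * (a ^+ 2 + b ^+ 2) - (z * c) ^+ 2); first by ring.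
  by rewrite cz z2; ring.
have zp : 0 < z ^+ 2 by rewrite z2; have := sqr_ge0 x; have := sqr_ge0 y; lra.
have sa := sqr_ge0 a; have sb := sqr_ge0 b; have sc := sqr_ge0 (x * b - y * a).
rewrite -(pmulr_rgt0 _ zp) E lt_neqAle; apply/andP; split; last by rewrite !addr_ge0.
apply/negP => /eqP S0.
have a0 : a = 0 by apply/eqP; rewrite -sqrf_eq0 eq_le sa andbT; lra.
have b0 : b = 0 by apply/eqP; rewrite -sqrf_eq0 eq_le sb andbT; lra.
have z0 : z != 0 by apply: contraTneq zp => ->; rewrite expr0n /= ltxx.
have c0 : c = 0 by apply: (mulfI z0); rewrite cz a0 b0 !mulr0 addr0.
by move/eqP: X0; apply; apply: row3P; rewrite mxE.
Qed.

End LorentzAlgebra.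

(** * The Hessian of the inner product *)

Section Hessian.
Context {R : realType}.
Variable g : R -> 'rV[R]_3.
Local Notation form := (@spacelike_form R).
Local Notation g1 := (derive1 g).
Local Notation g2 := (derive1 (derive1 g)).
Hypothesis sm : smooth g.
Variable e : R.
(** Taking [e] to be -1 or 1 covers both [timelike_form] and [spacelike_form]. *)
Let phi (q : R * R) : R := e * form (g q.1) (g q.2).

Let d0 t : derivable g t 1. Proof. by have := @sm 0%N t; rewrite derive1n0. Qed.
Let d1 t : derivable g1 t 1. Proof. by have := @sm 1%N t; rewrite derive1n1. Qed.
Arguments d0 : clear implicits.
Arguments d1 : clear implicits.

Lemma derive_phi (w : R * R) : 'D_w phi =
  (fun q : R * R => e * (w.1 * form (g1 q.1) (g q.2) + w.2 * form (g q.1) (g1 q.2))).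
Proof.
apply/funext => q.
have H := is_deriveZ e (is_derive_form2 w (d0 q.1) (d0 q.2)).
exact: (@derive_val _ _ _ _ _ _ _ H).
Qed.

Lemma derive2_phi (v w p : R * R) : 'D_v ('D_w phi) p =
  e * (w.1 * (v.1 * form (g2 p.1) (g p.2) + v.2 * form (g1 p.1) (g1 p.2)) +
       w.2 * (v.1 * form (g1 p.1) (g1 p.2) + v.2 * form (g p.1) (g2 p.2))).
Proof.
rewrite derive_phi.
have H1 := is_derive_form2 v (d1 p.1) (d0 p.2).
have H2 := is_derive_form2 v (d0 p.1) (d1 p.2).
have H := is_deriveZ e (is_deriveD (is_deriveZ w.1 H1) (is_deriveZ w.2 H2)).
exact: (@derive_val _ _ _ _ _ _ _ H).
Qed.

Lemma phi_critical p : form (g1 p.1) (g p.2) = 0 -> form (g p.1) (g1 p.2) = 0 ->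
  critical_point phi p.
Proof.
move=> h1 h2 v; rewrite -[LHS]/((fun q => 'D_v phi q) p) derive_phi /=.
by rewrite h1 h2 !mulr0 addr0 mulr0.
Qed.

Lemma phi_nondegenerate p : Defs.nondegenerate phi p -> hess_det g p.1 p.2 != 0.
Proof.
move=> nd; rewrite /hess_det; apply/eqP.
set A := form (g2 _) _; set C := form _ (g2 _); set M := form (g1 _) _ => D0.
have key x y : x * A + y * M = 0 -> x * M + y * C = 0 -> (x, y) = (0 : R * R).
  by move=> h1 h2; apply: nd => w; rewrite derive2_phi /= -/A -/M -/C h1 h2 !mulr0 addr0 mulr0.
(* If the determinant vanishes, [(M, - A)] is in the kernel of the Hessian; if this vector is zero,
   [(1, 0)] is. *)
have [h1|/eqP h1] := eqVneq ((M, - A) : R * R) 0.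
  have [M0 A0] : M = 0 /\ A = 0 by case: h1 => -> /eqP; rewrite oppr_eq0 => /eqP ->.
  have : (1, 0) = 0 :> R * R by apply: key; rewrite M0 ?A0; ring.
  by case=> /eqP; rewrite oner_eq0.
by apply: h1; apply: key; [ring|rewrite -[RHS]oppr0 -D0; ring].
Qed.

End Hessian.

(** * Counting *)

Lemma counting_seq (R : realType) (T : choiceType) (s : seq T) : uniq s ->
  counting [set` s] = (size s)%:R%:E :> \bar R.
Proof.
move=> us; rewrite /counting asboolT //.
have -> : [set` s] = [set` [fset x in s]%fset].
  by apply/seteqP; split => x /=; rewrite !inE.
by rewrite set_fsetK card_fseq undup_id.
Qed.

Lemma counting_ge_size (R : realType) (T : choiceType) (s : seq T) (E : set T) :
  uniq s -> [set` s] `<=` E -> ((size s)%:R%:E <= counting E :> \bar R)%E.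
Proof.
move=> us sE; rewrite /counting; case: asboolP => finE; last by rewrite leey.
rewrite lee_fin ler_nat -(undup_id us) -card_fseq; apply: fsubset_leq_card.
by apply/fsubsetP => x; rewrite inE => xs; rewrite in_fset_set //; apply/mem_set; exact: sE.
Qed.

Lemma sum_sgz_count (R : realDomainType) (T : eqType) (f : T -> R) (s : seq T) :
  \sum_(x <- s) sgz (f x) = (count (fun x => 0 < f x) s)%:Z - (count (fun x => f x < 0) s)%:Z.
Proof.
elim: s => [|x s IH]; first by rewrite big_nil subrr.
rewrite big_cons IH /= !PoszD.
by case: (sgzP (f x)) => _ /=; ring.
Qed.

Lemma sub_in_count (T : eqType) (a b : pred T) (s : seq T) :
  {in s, forall x, a x -> b x} -> (count a s <= count b s)%N.
Proof.
move=> ab; rewrite (eq_in_count (a2 := predI a b)); first by apply: sub_count => x /andP[].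
by move=> x /ab abx /=; case: (a x) abx => // ->.
Qed.

(** * Coincidences, parallel tangents and their numbers *)

Section Curve.
#[local] Opaque derive1 spacelike_form.
Context {R : realType}.
Variables (g : R -> 'rV[R]_3) (sigma e : R).
Local Notation form := (@spacelike_form R).
Local Notation g1 := (derive1 g).
Local Notation g2 := (derive1 (derive1 g)).
Hypothesis per : forall t, g (t + 1) = g t.
Hypothesis sm : smooth g.
Hypothesis gg : forall t, form (g t) (g t) = sigma.
Hypothesis pos : forall t, 0 < form (g1 t) (g1 t).
Hypothesis sigma0 : sigma != 0.
Hypothesis immersed : forall t, g1 t != 0.
Hypothesis gen : generic (fun u v => e * form u v) g.

(** By [form_acceleration], the product of the pure second derivatives is that of the squares of the
    two tangents, the signs cancelling. So the Hessian determinant is the Gram determinant of the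
    tangents, both orthogonal to [g p.1], and [tangent_gram_neq0] gives its sign. *)
Lemma hess_det_coincidence p : free [:: g1 p.1; g1 p.2] ->
  g p.2 = g p.1 \/ g p.2 = - g p.1 ->
  [/\ form (g1 p.1) (g p.2) = 0, form (g p.1) (g1 p.2) = 0 & hess_det g p.1 p.2 * sigma < 0].
Proof.
have key (u u1 u2 v v1 v2 : 'rV[R]_3) : v = u \/ v = - u ->
    form u u = sigma -> form u u1 = 0 -> form v v1 = 0 ->
    form u u2 = - form u1 u1 -> form v v2 = - form v1 v1 -> free [:: u1; v1] ->
    [/\ form u1 v = 0, form u v1 = 0 &
        (form u2 v * form u v2 - form u1 v1 ^+ 2) * sigma < 0].
  move=> uv us uu1 vv1 uu2 vv2 fr.
  have uv1 : form u v1 = 0.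
    by case: uv vv1 => -> //; rewrite formNl => /eqP; rewrite oppr_eq0 => /eqP.
  have u1v : form u1 v = 0 by rewrite formC; case: uv => ->; rewrite ?formNl uu1 ?oppr0.
  have u0 : form u u != 0 by rewrite us.
  have u1u : form u1 u = 0 by rewrite formC.
  have v1u : form v1 u = 0 by rewrite formC.
  have := tangent_gram_neq0 u0 u1u v1u fr; rewrite us => det0; split => //.
  rewrite (_ : form u2 v * form u v2 = form u1 u1 * form v1 v1) //.
  rewrite (formC u2 v); case: uv => uv.
    by rewrite uv uu2 -uv vv2 mulrNN.
  have uv' : u = - v by rewrite uv opprK.
  by rewrite {1}uv formNl uu2 {1}uv' formNl vv2 !opprK.
move=> fr H; apply: key H (gg _) (form_velocity sm gg _) (form_velocity sm gg _)
  (form_acceleration sm gg _) (form_acceleration sm gg _) fr.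
Qed.

Let A p := double_points g p.
Let B p := antipodal_points g p.

(** Both tangents are orthogonal to both points, which are independent away from coincidences. *)
Lemma critical_pairs_parallel p : critical_pairs g p -> ~ A p -> ~ B p -> parallel_tangents g p.
Proof.
move=> [p0 p12 p1 z1 z2] nA nB.
have tp : torus p by split; rewrite /circle /=; lra.
have pne : p.1 != p.2 by rewrite lt_eqF.
split; [exact: tp|exact: pne|].
have h1 : form (g1 p.1) (g p.1) = 0 by rewrite formC (form_velocity sm gg).
have h2 : form (g1 p.2) (g p.2) = 0 by rewrite formC (form_velocity sm gg).
have z2' : form (g1 p.2) (g p.1) = 0 by rewrite formC.
apply: (orthogonal_parallel _ (immersed _) (immersed _) h1 z1 z2' h2).
apply: (cross_neq0 sigma0 (gg _) (gg _)) => h; first exact: nA.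
by apply: nB; split; [exact: tp|rewrite h opprK].
Qed.

Lemma coincidence_critical p : p.1 < p.2 -> A p \/ B p ->
  critical_pairs g p /\ hess_det g p.1 p.2 * sigma < 0.
Proof.
move=> lt AB.
have fr : free [:: g1 p.1; g1 p.2] by apply: gen.1; case: AB; [left|right].
have [tp H] : torus p /\ (g p.2 = g p.1 \/ g p.2 = - g p.1).
  by case: AB => [[tp _ E]|[tp E]]; split => //; [left|right].
have [z1 z2 D] := hess_det_coincidence fr H.
by case: tp => /andP[? ?] /andP[? ?]; split.
Qed.

(** Transversality handles the coincidences, the Morse condition all other pairs. *)
Lemma critical_pairs_regular p : critical_pairs g p -> hess_det g p.1 p.2 != 0.
Proof.
move=> cp; have [p0 p12 p1 z1 z2] := cp.
have [AB|nAB] := pselect (A p \/ B p).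
  have [_ D] := coincidence_critical p12 AB.
  by apply: contraTneq D => ->; rewrite mul0r ltxx.
apply: (phi_nondegenerate sm (e := e)); apply: gen.2; last exact: phi_critical.
split; first by split; rewrite /circle /=; lra.
case=> [[AB|AB]|[_ E]]; [by apply: nAB; left|by apply: nAB; right|].
by rewrite E ltxx in p12.
Qed.

(** Here [n] is the number of critical pairs with positive Hessian determinant, equal to that with
    negative one. The last clause ensures that the natural subtraction does not truncate. *)
Lemma num_pairs_parallel : exists na nb n : nat,
  [/\ num_pairs (double_points g) = na%:R%:E, num_pairs (antipodal_points g) = nb%:R%:E,
      ((n.*2 - (na + nb))%N%:R%:E <= num_pairs (parallel_tangents g))%E, (0 < n)%N &
      if sigma < 0 then (na + nb < n)%N else (na + nb <= n)%N].
Proof.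
have [T [uT HT sum0]] := critical_pairs_index per sm gg pos critical_pairs_regular.
have [m [cm Dm Fm]] := critical_minimum per sm gg pos critical_pairs_regular.
pose a p := `[< A p >]; pose b p := `[< B p >].
pose P p := 0 < hess_det g p.1 p.2; pose N p := hess_det g p.1 p.2 < 0.
have lt_count (E : set (R * R)) : (forall p, p.1 < p.2 -> E p -> p \in T) ->
    num_pairs E = (count (fun p => `[< E p >]) T)%:R%:E.
  move=> ET; rewrite /num_pairs -size_filter -counting_seq ?filter_uniq //; congr counting.
  apply/seteqP; split => p /=; rewrite mem_filter.
    by move=> [Ep lt]; rewrite asboolT // ET.
  by move=> /andP[/asboolP Ep /HT[]].
have AT p : p.1 < p.2 -> A p \/ B p -> p \in T.
  by move=> lt AB; apply/HT; have [] := coincidence_critical lt AB.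
(* A pair of both kinds would have [g p.2 = - g p.2], contradicting [sigma != 0]. *)
have ABdis p : p \in T -> a p && b p = false.
  move=> _; apply/negP => /andP[/asboolP[_ _ E] /asboolP[_ E']].
  move/eqP: sigma0; apply; rewrite -(gg p.2).
  have : form (g p.2) (g p.2) = - form (g p.2) (g p.2) by rewrite {2}E' E formNr.
  by move/eqP; rewrite -addr_eq0 -mulr2n mulrn_eq0 /= => /eqP.
have PN : count P T = count N T.
  by move: sum0; rewrite sum_sgz_count => /eqP; rewrite subr_eq0 => /eqP [].
have sizeT : size T = (count P T + count N T)%N.
  rewrite -(count_predC P); congr (_ + _)%N; apply: eq_in_count => p /HT cp /=.
  by rewrite /P /N -leNgt le_eqVlt (negbTE (critical_pairs_regular cp)).
have AB_count : count (predU a b) T = (count a T + count b T)%N.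
  rewrite -count_predUI [count (predI a b) T](eq_in_count (a2 := pred0)) ?count_pred0 ?addn0 //.
have AB_sign p : p \in T -> predU a b p -> hess_det g p.1 p.2 * sigma < 0.
  move=> /HT[_ lt _ _ _] /orP[/asboolP Ap|/asboolP Bp].
    by have [] := coincidence_critical lt (or_introl Ap).
  by have [] := coincidence_critical lt (or_intror Bp).
exists (count a T), (count b T), (count P T); split.
- by apply: lt_count => p lt Ap; apply: AT lt _; left.
- by apply: lt_count => p lt Bp; apply: AT lt _; right.
- have -> : ((count P T).*2 - (count a T + count b T))%N = size [seq p <- T | ~~ predU a b p].
    by rewrite size_filter -AB_count -addnn {2}PN -sizeT -(count_predC (predU a b)) addKn.
  apply: counting_ge_size; first exact: filter_uniq.
  move=> p /=; rewrite mem_filter negb_or => /andP[/andP[/asboolP nA /asboolP nB] /HT cp].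
  by split; [exact: critical_pairs_parallel|case: cp].
- by rewrite -has_count; apply/hasP; exists m => //; apply/HT.
rewrite -AB_count; case: ifP => [s0|/negbT s0].
  (* For negative [sigma] coincidences have positive determinant. So has the minimum [m], which is
     no coincidence: there the form is [sigma] or [- sigma], not less than [sigma]. This makes the
     inequality strict. *)
  have sub : (count (predU a b) T + (count (pred1 m) T) <= count P T)%N.
    rewrite -count_predUI [count (predI _ _) T](eq_in_count (a2 := pred0)); last first.
      move=> p pT /=; apply/negP => /andP[ab /eqP pm].
      move: Fm; rewrite -pm; case/orP: ab => /asboolP; first by case=> _ _ ->; rewrite gg ltxx.
      by case=> [_ ->]; rewrite formNr gg; lra.
    rewrite count_pred0 addn0; apply: sub_in_count => p pT /orP[ab|/eqP->//].
    by have := AB_sign p pT ab; rewrite nmulr_llt0.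
  apply: leq_trans sub; rewrite -addn1 leq_add2l -has_count has_pred1.
  exact/HT.
(* For positive [sigma] coincidences are saddles, so they are compared with [N]. *)
rewrite PN; apply: sub_in_count => p pT ab.
have s1 : 0 < sigma by rewrite lt_neqAle eq_sym sigma0 leNgt.
by have := AB_sign p pT ab; rewrite pmulr_llt0.
Qed.

End Curve.

Theorem theorem2 (R : realType) :
  (forall g : R -> 'rV[R]_3,
     smooth_closed_immersed g ->
     (forall t : R, upper_sheet (g t)) ->
     generic timelike_form g ->
     (num_pairs (double_points g) + 2 <= num_pairs (parallel_tangents g))%E)
  /\
  (forall g : R -> 'rV[R]_3,
     smooth_closed_immersed g ->
     (forall t : R, one_sheet (g t)) ->
     (forall t : R, 0 < spacelike_form (derive1 g t) (derive1 g t)) ->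
     generic spacelike_form g ->
     (num_pairs (double_points g) + num_pairs (antipodal_points g)
        <= num_pairs (parallel_tangents g))%E /\
     (num_pairs (double_points g) = 0%E ->
      num_pairs (antipodal_points g) = 0%E ->
      (2 <= num_pairs (parallel_tangents g))%E)).
Proof.
split=> g [per sm im] sheet.
  move=> gen.
  have gg t : spacelike_form (g t) (g t) = -1.
    have [h _] := sheet t; rewrite /spacelike_form -!expr2 -h; ring.
  have pos t : 0 < spacelike_form (derive1 g t) (derive1 g t).
    by apply: (timelike_orthogonal_pos (gg t) (im t)); rewrite formC (form_velocity sm gg).
  have gen' : generic (fun u v => -1 * spacelike_form u v) g.
    rewrite (_ : (fun u v => _) = timelike_form) //; apply/funext => u; apply/funext => v.
    by rewrite /timelike_form /spacelike_form; ring.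
  have m10 : -1 != 0 :> R by rewrite oppr_eq0 oner_eq0.
  have [na [nb [n [-> _ le _]]]] := num_pairs_parallel per sm gg pos m10 im gen'.
  rewrite ltrN10 => lt; apply: le_trans le.
  (* From [na + nb + 1 <= n] follows [2 n - (na + nb) >= na + nb + 2]. *)
  by rewrite -EFinD lee_fin -natrD ler_nat; lia.
move=> pos gen.
have gg t : spacelike_form (g t) (g t) = 1.
  by rewrite -(sheet t) /spacelike_form !expr2.
have gen' : generic (fun u v => 1 * spacelike_form u v) g.
  by rewrite (_ : (fun u v => _) = spacelike_form) //; apply/funext => u; apply/funext => v; rewrite mul1r.
have [na [nb [n [-> -> le n0]]]] := num_pairs_parallel per sm gg pos (oner_neq0 _) im gen'.
rewrite ltr10 => lt; split.
  by apply: le_trans le; rewrite -EFinD lee_fin -natrD ler_nat; lia.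
move=> [/eqP]; rewrite pnatr_eq0 => /eqP a0 [/eqP]; rewrite pnatr_eq0 => /eqP b0.
(* With no coincidences the bound is [2 n], and the minimum provides [n >= 1]. *)
by apply: le_trans le; rewrite lee_fin ler_nat; lia.
Qed.
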